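(* Let $\delta>0$, let $\kappa,\alpha,\beta$ be real, let $\sigma_r,\sigma_x,\sigma_\pi\ge0$, and let $$\rho=\begin{pmatrix}1&\rho_{rS}&\rho_{r\pi}\\ \rho_{rS}&1&\rho_{S\pi}\\ \rho_{r\pi}&\rho_{S\pi}&1\end{pmatrix}$$ be a correlation matrix of full rank. Let $\Sigma(\delta)$ be the variance-covariance matrix of the seven-dimensional vector $Y_\delta$ defined in the context, let $C(\delta)$ be the matrix $\Sigma(\delta)$ obtained when $\sigma_r=\sigma_x=\sigma_\pi=1$, and let $D=\mathrm{diag}(\sigma_r,\sigma_r,\sigma_x,\sigma_x,\sigma_\pi,\sigma_\pi,1)$. Then: (i) $\Sigma(\delta)=D\,C(\delta)\,D$. Consequently, if $Z\sim N_7(0,C(\delta))$ and $m$ denotes the mean vector of $Y_\delta$ given the initial values, then $m+DZ$ has the distribution $N_7(m,\Sigma(\delta))$ of $Y_\delta$. (ii) The 6-by-6 matrix obtained from $C(\delta)$ by removing its last row and column, i.e. the variance-covariance matrix of the first six components $(Z_1,\dots,Z_6)$ of $Z\sim N_7(0,C(\delta))$, has full rank, so that $(Z_1,\dots,Z_6)$ can be simulated by standard Cholesky decomposition of this 6-by-6 matrix. (iii) If $(Z_1,\dots,Z_6)'$ is a centered normal vector whose covariance matrix is $C(\delta)$ with its last row and column removed, and one sets $$Z_7=-Z_3-\alpha Z_4,$$ then $Z=(Z_1,\dots,Z_7)'\sim N_7(0,C(\delta))$. Hence $Y_\delta$ can be simulated as $m+DZ$ with $Z$ generated as in (ii) and (iii),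 and this procedure works also when one or more of the volatilities $\sigma_r,\sigma_x,\sigma_\pi$ are zero.
   Context: Let $(W^r,W^S,W^\pi)'$ be a vector Brownian motion started at $0$ with unit variances and correlation matrix $\rho$, and let $dr_t=\kappa(\bar r-r_t)dt+\sigma_r dW^r_t$, $dx_t=\alpha(\bar x-x_t)dt-\sigma_x dW^S_t$, $d\pi_t=\beta(\bar\pi-\pi_t)dt+\sigma_\pi dW^\pi_t$, with deterministic initial values $r_0,x_0,\pi_0$ and real constants $\bar r,\bar x,\bar\pi$. For $t\ge0$ let $$Y_t=\Big(r_t,\int_0^t r_sds,\;x_t,\int_0^t x_sds,\;\pi_t,\int_0^t\pi_sds,\;W^S_t\Big)'.$$ $Y_t$ is multivariate normal, and its variance-covariance matrix $\Sigma(t)$ depends only on $t$, $\kappa,\alpha,\beta,\sigma_r,\sigma_x,\sigma_\pi$ and $\rho$ (not on the initial values or on $\bar r,\bar x,\bar\pi$). Normal distributions are allowed to be degenerate. *)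

(* Defs.v *)
From HB Require Import structures.
From mathcomp Require Import all_boot all_order all_algebra.
From mathcomp Require Import all_classical all_reals all_analysis.

Set Implicit Arguments.
Unset Strict Implicit.
Unset Printing Implicit Defensive.

Import Order.TTheory GRing.Theory Num.Theory.
Import numFieldNormedType.Exports.

Local Open Scope classical_set_scope.
Local Open Scope ring_scope.

Definition colv (R : realType) (n : nat) (s : seq R) : 'cV[R]_n :=
  \col_(i < n) s`_i.

Definition is_correlation_mx (R : realType) (n : nat) (A : 'M[R]_n) : Prop :=
  [/\ A^T = A,
      forall i, A i i = 1 &
      forall v : 'cV[R]_n, 0 <= (v^T *m A *m v) 0 0].

(* Order of the noises: W^r, W^S, W^pi. *)
Definition corr_mx (R : realType) (rho_rS rho_rp rho_Sp : R) : 'M[R]_3 :=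
  \matrix_(i < 3, j < 3)
    (nth [::] [:: [:: 1;      rho_rS; rho_rp];
                  [:: rho_rS; 1;      rho_Sp];
                  [:: rho_rp; rho_Sp; 1     ]] i)`_j.

Definition mean_vec d (T : measurableType d) (R : realType)
    (P : probability T R) n (X : T -> 'cV[R]_n) : 'cV[R]_n :=
  \col_i fine 'E_P[fun w => X w i 0%R]%E.

Definition cov_mx d (T : measurableType d) (R : realType)
    (P : probability T R) n (X : T -> 'cV[R]_n) : 'M[R]_n :=
  \matrix_(i, j) fine (covariance P (fun w => X w i 0) (fun w => X w j 0)).

(* Zero variance (a point mass) is treated separately, because the library's
   normal_prob m 0 is not a point mass. *)
Definition normal_rv d (T : measurableType d) (R : realType)
    (P : probability T R) (X : T -> R) : Prop :=
  measurable_fun setT X /\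
  exists m s : R, 0 <= s /\
    forall B : set R, measurable B ->
      P (X @^-1` B) = (if s == 0 then \d_m B else normal_prob m s B).

(* X ~ N_n(m, S), possibly degenerate. By the Cramer-Wold theorem the law of X
   is determined by m and S. *)
Definition multinormal d (T : measurableType d) (R : realType)
    (P : probability T R) n (X : T -> 'cV[R]_n)
    (m : 'cV[R]_n) (S : 'M[R]_n) : Prop :=
  [/\ forall a : 'cV[R]_n, normal_rv P (fun w => (a^T *m X w) 0 0),
      mean_vec P X = m &
      cov_mx P X = S].

Definition sigma_rv d (T : measurableType d) (R : realType) n
    (X : T -> 'cV[R]_n) : set (set T) :=
  g_sigma_preimage (fun (i : 'I_n) (w : T) => X w i 0).

(* Independence of X_0, ..., X_(N-1). Subfamilies are covered by taking some
   of the A k to be setT. *)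
Definition independent_rvs d (T : measurableType d) (R : realType)
    (P : probability T R) n (N : nat) (X : nat -> T -> 'cV[R]_n) : Prop :=
  forall A : nat -> set T,
    (forall k, (k < N)%N -> sigma_rv (X k) (A k)) ->
    P (\bigcap_(k in `I_N) A k) = (\prod_(k < N) P (A k))%E.

Definition continuous_paths (T : Type) (R : realType) (X : R -> T -> R) :
  Prop := forall w, {within `[0, +oo[, continuous (fun t : R => X t w)}.

Record vector_brownian d (T : measurableType d) (R : realType)
    (P : probability T R) n (rho : 'M[R]_n) (W : R -> T -> 'cV[R]_n) : Prop := {
  vbm_measurable : forall t i, 0 <= t ->
    measurable_fun setT (fun w => W t w i 0);
  vbm_start : {ae P, forall w, W 0 w = 0};
  vbm_continuous : forall i, continuous_paths (fun t w => W t w i 0);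
  vbm_increment : forall s t, 0 <= s -> s <= t ->
    multinormal P (fun w => W t w - W s w) 0 ((t - s) *: rho);
  vbm_independent : forall (N : nat) (t : nat -> R),
    0 <= t 0%N -> (forall k, t k <= t k.+1) ->
    independent_rvs P N (fun k w => W (t k.+1) w - W (t k) w)
}.

Definition time_int (T : Type) (R : realType) (X : R -> T -> R) (t : R)
    (w : T) : R :=
  \int[lebesgue_measure]_(u in `[0, t]) X u w.

(* X is a continuous solution of dX_t = k (m - X_t) dt + s dB_t, X_0 = y.
   The noise is additive, so that the stochastic integral of the constant s
   is s * B_t. *)
Record OU_process d (T : measurableType d) (R : realType)
    (P : probability T R) (k m s y : R) (B X : R -> T -> R) : Prop := {
  OU_measurable : forall t, 0 <= t -> measurable_fun setT (X t);
  OU_continuous : continuous_paths X;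
  OU_equation : {ae P, forall w, forall t, 0 <= t ->
    X t w = y + time_int (fun u w => k * (m - X u w)) t w + s * B t w}
}.

(* The process pi is called p. Each of r, x, p has its own long-run mean
   (rbar, xbar, pbar) and deterministic initial value (r0, x0, p0). *)
Record model d (T : measurableType d) (R : realType) (P : probability T R)
    (rho : 'M[R]_3) (kappa alpha beta sr sx sp : R)
    (rbar xbar pbar r0 x0 p0 : R)
    (Wr WS Wp r x p : R -> T -> R) : Prop := {
  model_BM :
    vector_brownian P rho (fun t w => colv 3 [:: Wr t w; WS t w; Wp t w]);
  model_r : OU_process P kappa rbar sr r0 Wr r;
  model_x : OU_process P alpha xbar (- sx) x0 WS x;
  model_p : OU_process P beta pbar sp p0 Wp p
}.

Definition Yvec (T : Type) (R : realType) (WS r x p : R -> T -> R) (t : R)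
    (w : T) : 'cV[R]_7 :=
  colv 7 [:: r t w; time_int r t w; x t w; time_int x t w;
             p t w; time_int p t w; WS t w].

Definition vol_mx (R : realType) (sr sx sp : R) : 'M[R]_7 :=
  diag_mx (colv 7 [:: sr; sr; sx; sx; sp; sp; 1])^T.

Definition is_cholesky (R : realType) n (A L : 'M[R]_n) : Prop :=
  [/\ is_trig_mx L, forall i, 0 < L i i & L *m L^T = A].

Definition drop_last_mx (R : realType) n (A : 'M[R]_n.+1) : 'M[R]_n :=
  row' ord_max (col' ord_max A).

Definition drop_last (R : realType) n (v : 'cV[R]_n.+1) : 'cV[R]_n :=
  row' ord_max v.

(* Z_7 = - Z_3 - alpha Z_4, with 0-based indices. *)
Definition seventh_rule (R : realType) (alpha : R) (z : 'cV[R]_7) : Prop :=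
  z (inord 6) 0 = - z (inord 2) 0 - alpha * z (inord 3) 0.

(* Main.v *)
Require Import Defs.
From HB Require Import structures.
From mathcomp Require Import all_boot all_order all_algebra.
From mathcomp Require Import all_classical all_reals all_analysis.
From mathcomp Require Import measurable_realfun ring lra zify.

Set Implicit Arguments.
Unset Strict Implicit.
Unset Printing Implicit Defensive.

Import Order.TTheory GRing.Theory Num.Theory.
Import numFieldNormedType.Exports.

Local Open Scope classical_set_scope.
Local Open Scope ring_scope.

(** The equations with additive noise can be solved path by path: the integral
    [I] of a component up to time [d] equals [expR (- k d)] times a constant plus
    the volatility times [K], the integral of [expR (k u) * B u] over [[0, d]],
    and the component itself is a constant minus [k I] plus the volatility times
    [B d].  So every linear combination of the entries of [Y] is almost surely a
    constant plus a linear functional of [(B d, K)] of the three noises, whose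
    coefficients depend on the volatilities only through the scaling by [D], and
    vanish for the combination [Z_3 + alpha Z_4 + Z_7].

    Replacing [K] by Riemann sums turns such a functional into a sum of
    independent normal increments, centered and with an explicit variance; these
    variances are bounded, and bounded away from [0] unless all coefficients
    vanish.  Almost sure limits of normal variables are normal with variance any
    cluster point of the variances.  This gives one function of the coefficients
    which is the variance in every model, and since a covariance matrix is
    determined by its quadratic form, everything follows by comparing quadratic
    forms. *)

(** * Normal laws as images of the standard normal law *)

(** No entry of C(delta) is ever computed. The two models live on unrelated probability spaces, so
    their variances are compared through a number fixed by data common to both: the correlation
    matrix, the rates, the horizon and the coefficients. A cluster point of the discrete variances
    is such a number and only requires them to stay in a segment; the lower end of that segment,
    positive for nonzero coefficients, is what gives full rank. The coefficient map has a single
    null direction, (0,0,1,alpha,0,0,1), which explains both why the last row and column are dropped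
    and why the rule for Z_7 restores them. Zero volatilities lead to degenerate laws, so a normal
    law is encoded as the law of m + s z with z standard normal, which stays meaningful, and
    continuous in s, at s = 0. *)

Lemma eq_measure_rays (R : realType)
    (mu nu : {measure set (measurableTypeR R) -> \bar R}) :
  (mu setT < +oo)%E ->
  (forall a : R, mu `]a, +oo[%classic = nu `]a, +oo[%classic) ->
  forall B, measurable B -> mu B = nu B.
Proof.
move=> muT munu B mB.
(* Open right rays are stable under intersection and generate the Borel sets; countably many of
   them, of finite mass, cover the line. *)
apply: (@measure_unique _ R (measurableTypeR R) (@RGenOInfty.G R)
    (fun n => `](- n%:R)%R, +oo[%classic)) => //.
- exact: RGenOInfty.measurableE.
- move=> _ _ [x ->] [y ->]; exists (Num.max x y).
  by apply/seteqP; split => z /=; rewrite !in_itv/= !andbT gt_max;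
    [case=> -> ->|move/andP].
- by move=> n; exists (- n%:R).
- rewrite -subTset => x _; exists (Num.truncn `|x|).+1 => //=.
  rewrite in_itv/= andbT ltrNl.
  by apply: le_lt_trans (truncnS_gt _); rewrite -normrN ler_norm.
- by move=> _ [x ->].
- by move=> k; apply: le_lt_trans muT; apply: le_measure; rewrite ?inE.
Qed.

(* Measures on the line live on [measurableTypeR R], which has the same sets as
   the canonical measurable structure of [R] but another display. *)
Definition real_mfun d (T : measurableType d) (R : realType)
    (X : T -> measurableTypeR R) (mX : measurable_fun setT X) :
    {mfun T >-> measurableTypeR R} :=
  mfun_Sub (mem_set mX).

(** The scale [s] may be zero, which gives the point mass at [m]; its sign is not constrained. *)
Definition has_normal_law d (T : measurableType d) (R : realType)
    (P : probability T R) (X : T -> R) (m s : R) : Prop :=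
  measurable_fun setT X /\
  forall B : set R, measurable B ->
    P (X @^-1` B) = normal_prob 0 1 [set z | B (m + s * z)].

Lemma measurable_affine (R : realType) (m s : R) :
  @measurable_fun _ _ (measurableTypeR R) R setT (fun z => m + s * z).
Proof.
by apply: measurable_funD => //; apply: measurable_funM => //; exact: measurable_id.
Qed.

Lemma normal_prob_ray (R : realType) (m s a : R) :
  normal_prob m s `]a, +oo[ =
  (\int[lebesgue_measure]_(x in `[a%R, +oo[) (normal_pdf m s x)%:E)%E.
Proof.
rewrite /normal_prob integral_itv_obnd_cbnd//.
by apply/measurable_EFinP/measurable_funTS; exact: measurable_normal_pdf.
Qed.

(** Comparison on open rays reduces this to the substitution x = m + s z in the density, whose
    Jacobian s cancels the factor 1/s of the peak. *)
Lemma normal_prob_affine (R : realType) (m s : R) : 0 < s ->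
  forall B : set R, measurable B ->
    normal_prob m s B = normal_prob 0 1 [set z | B (m + s * z)].
Proof.
move=> s0 B mB.
pose f : {mfun measurableTypeR R >-> measurableTypeR R} :=
  real_mfun (measurable_affine m s).
rewrite -[RHS]/(distribution (normal_prob (0:R) 1) f B).
apply: eq_measure_rays => //.
  by rewrite -ge0_fin_numE// fin_num_measure.
move=> a; have E : f @^-1` `]a, +oo[ = `](a - m) / s, +oo[%classic.
  apply/seteqP; split => z /=; rewrite !in_itv/= !andbT;
  by rewrite ltr_pdivrMr// [z * s]mulrC ltrBlDl.
transitivity (\int[lebesgue_measure]_(x in `[a%R, +oo[)
    (normal_pdf m s x)%:E)%E; first exact: normal_prob_ray.
transitivity (\int[lebesgue_measure]_(x in `[((a - m) / s)%R, +oo[)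
    (normal_pdf 0 1 x)%:E)%E; last first.
  by apply/esym; rewrite -normal_prob_ray -E.
pose F (z : R) := m + s * z.
have dF (z : R) : is_derive z 1 F s.
  rewrite /F; apply: is_derive_eq; rewrite /GRing.scale /=.
  by ring.
have F'E : F^`()%classic = cst s.
  by apply/funext => z; rewrite derive1E; apply: derive_val.
have Fa : F ((a - m) / s) = a by rewrite /F mulrC divfK ?gt_eqF// subrKC.
rewrite -{1}Fa increasing_ge0_integration_by_substitutiony.
- apply: eq_integral => z _; congr EFin; rewrite F'E /=.
  rewrite !normal_pdfE ?oner_eq0 ?gt_eqF//.
  rewrite /normal_fun /normal_peak /F expr1n.
  rewrite mulrAC; congr (_ * _).
    rewrite mul1r -mulrnAr sqrtrM ?sqr_ge0// sqrtr_sqr gtr0_norm// invfM.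
    rewrite -[LHS]/(s^-1 / Num.ExtraDef.sqrtr (pi *+ 2) * s).
    by rewrite mulrAC mulVf ?mul1r ?gt_eqF.
  congr expR; rewrite addrAC subrr add0r subr0 exprMn.
  by field; rewrite gt_eqF.
- by move=> x y _ _ xy; rewrite /F ltrD2l ltr_pM2l.
- by rewrite F'E => ? _; exact: cvg_cst.
- by rewrite F'E; exact: is_cvg_cst.
- by rewrite F'E; exact: is_cvg_cst.
- split=> [x _|]; first by have [] := dF x.
  apply: cvg_at_right_filter.
  apply: differentiable_continuous; apply/derivable1_diffP.
  by have [] := dF ((a - m) / s).
- apply/cvgryPge => A.
  have := nbhs_pinfty_ge (num_real ((A - m) / s)); apply: filterS => z.
  by rewrite /F ler_pdivrMr// mulrC lerBlDl.
- by apply: continuous_subspaceT; apply: continuous_normal_pdf; rewrite gt_eqF.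
- by move=> x _; exact: normal_pdf_ge0.
Qed.

(** The density is even, so the substitution of -z for z exchanges left and right rays. This yields
    the mean 0 without an antiderivative. *)
Lemma normal_prob_sym (R : realType) (B : set R) : measurable B ->
  normal_prob 0 1 [set z | B (- z)] = normal_prob (0 : R) 1 B.
Proof.
move=> mB.
have mf : @measurable_fun _ _ (measurableTypeR R) R setT (fun z => - z).
  exact: measurable_funN.
pose f : {mfun measurableTypeR R >-> measurableTypeR R} :=
  real_mfun mf.
rewrite -[LHS]/(distribution (normal_prob (0:R) 1) f B).
apply: eq_measure_rays => //.
  by rewrite -ge0_fin_numE// fin_num_measure.
move=> a; have E : f @^-1` `]a, +oo[ = `]-oo, - a[%classic.
  by apply/seteqP; split => z /=; rewrite !in_itv/= !andbT ltrNr.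
transitivity (\int[lebesgue_measure]_(x in `]-oo, (- a)%R])
    (normal_pdf 0 1 x)%:E)%E.
  transitivity (normal_prob (0:R) 1 `]-oo, - a[); first by rewrite -E.
  rewrite /normal_prob integral_itv_bndo_bndc//.
  by apply/measurable_EFinP/measurable_funTS; exact: measurable_normal_pdf.
transitivity (\int[lebesgue_measure]_(x in `[a%R, +oo[)
    (normal_pdf 0 1 x)%:E)%E; last by apply/esym; exact: normal_prob_ray.
rewrite ge0_integration_by_substitutionNy.
- apply: eq_integral => z _; congr EFin => /=.
  rewrite !normal_pdfE ?oner_eq0// /normal_fun.
  by rewrite !subr0 sqrrN.
- by apply: continuous_subspaceT; apply: continuous_normal_pdf; rewrite gt_eqF.
- by move=> x _; exact: normal_pdf_ge0.
Qed.

(** * Integration against normal densities, and moments *)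

(** The Radon-Nikodym derivative of the normal law has the same integral as the density over every
    measurable set, hence equals it almost everywhere, and the change of variables for that
    derivative applies. *)
Lemma ge0_integral_normal_prob (R : realType) (m s : R) (f : R -> \bar R) :
  measurable_fun setT f -> (forall x, 0 <= f x)%E ->
  (\int[normal_prob m s]_x f x =
   \int[lebesgue_measure]_x (f x * (normal_pdf m s x)%:E))%E.
Proof.
move=> mf f0.
have dom := normal_prob_dominates m s.
rewrite -(Radon_Nikodym_SigmaFinite.change_of_variables dom f0)//.
have irn := Radon_Nikodym_SigmaFinite.f_integrable dom.
have mrn := measurable_int _ irn.
have mp : measurable_fun setT (fun x => (normal_pdf m s x)%:E).
  by apply/measurable_EFinP; exact: measurable_normal_pdf.
apply: ge0_ae_eq_integral => //.
- exact: emeasurable_funM.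
- exact: emeasurable_funM.
- by move=> x _; apply: mule_ge0 => //; exact: Radon_Nikodym_SigmaFinite.f_ge0.
- by move=> x _; apply: mule_ge0 => //; rewrite lee_fin normal_pdf_ge0.
- apply: ae_eqe_mul2l.
  apply: integral_ae_eq => //.
  by move=> E _ mE; rewrite -Radon_Nikodym_SigmaFinite.f_integral.
Qed.

Lemma normal_pdf01E (R : realType) (z : R) :
  normal_pdf 0 1 z = normal_peak 1 * expR (- z ^+ 2 / 2).
Proof. by rewrite normal_pdfE ?oner_eq0// /normal_fun subr0 expr1n. Qed.

Lemma is_derive_normal_pdf01 (R : realType) (z : R) :
  is_derive z 1 (normal_pdf 0 1) (- z * normal_pdf 0 1 z).
Proof.
have -> : normal_pdf 0 1 = (fun z : R => normal_peak 1 * expR (- z ^+ 2 / 2)).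
  by apply/funext => x; exact: normal_pdf01E.
have h : is_derive z 1 (fun z : R => - z ^+ 2 / 2) (- z).
  by apply: is_derive_eq; rewrite /GRing.scale/=; field.
have h2 := @is_derive1_comp R expR _ z _ _ (is_derive_expR _) h.
 have h3 := is_deriveM (is_derive_cst (normal_peak 1) z 1) h2.
by apply: is_derive_eq; rewrite /GRing.scale/= /cst/=; ring.
Qed.

(** Half of the exponent is spent: z^2 / 2 = z^2 / 4 + z^2 / 4 and z^2 <= 4 exp(z^2 / 4). What is
    left is, up to the peaks, the density of variance 2, an integrable majorant. *)
Lemma normal_peak_bound (R : realType) (z : R) :
  z ^+ 2 * normal_pdf 0 1 z <=
  4 * normal_peak 1 / normal_peak (Num.sqrt 2) * normal_pdf 0 (Num.sqrt 2) z.
Proof.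
have s20 : Num.sqrt 2 != 0 :> R by rewrite gt_eqF// sqrtr_gt0.
rewrite normal_pdf01E normal_pdfE// /normal_fun subr0 sqr_sqrtr//.
have p0 := normal_peak_gt0 s20; have p10 := normal_peak_ge0 (1 : R).
have -> : - z ^+ 2 / 2 = - z ^+ 2 / (2 *+ 2) + - (z ^+ 2 / 4) by field.
rewrite expRD expRN; set e := expR (- z ^+ 2 / (2 *+ 2)).
have -> : 4 * normal_peak 1 / normal_peak (Num.sqrt 2) *
    (normal_peak (Num.sqrt 2) * e) = normal_peak 1 * e * 4.
  by field; rewrite gt_eqF.
have -> : z ^+ 2 * (normal_peak 1 * (e * (expR (z ^+ 2 / 4))^-1)) =
    normal_peak 1 * e * (z ^+ 2 / expR (z ^+ 2 / 4)) by ring.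
rewrite ler_wpM2l ?mulr_ge0 ?expR_ge0// ler_pdivrMr ?expR_gt0//.
have := expR_ge1Dx (z ^+ 2 / 4); lra.
Qed.

Lemma integrable_sqr_normal_pdf (R : realType) :
  lebesgue_measure.-integrable [set: R]
    (fun z => (z ^+ 2 * normal_pdf 0 1 z)%:E).
Proof.
pose C : R := 4 * normal_peak 1 / normal_peak (Num.sqrt 2).
apply: (@le_integrable _ _ _ lebesgue_measure _ measurableT _
   (fun z => (C%:E * (normal_pdf 0 (Num.sqrt 2) z)%:E)%E)).
- apply/measurable_EFinP/measurable_funM; last exact: measurable_normal_pdf.
  by apply: measurable_funX; exact: measurable_id.
- move=> z _; rewrite -EFinM !abse_EFin lee_fin.
  have h0 : 0 <= z ^+ 2 * normal_pdf 0 1 z.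
    by apply: mulr_ge0; [exact: sqr_ge0|exact: normal_pdf_ge0].
  rewrite (ger0_norm h0).
  by apply: le_trans (normal_peak_bound z) _; exact: ler_norm.
- have := integrableZl measurableT C (integrable_normal_pdf 0 (Num.sqrt (2 : R))).
  exact.
Qed.

(** With phi the density, z phi(z) is an antiderivative of phi - z^2 phi and vanishes at both
    infinities, so the second moment equals the total mass. *)
Lemma lebesgue_second_moment_normal (R : realType) :
  (\int[lebesgue_measure]_z (z ^+ 2 * normal_pdf (0 : R) 1 z)%:E = 1)%E.
Proof.
pose g (z : R) := normal_pdf 0 1 z - z ^+ 2 * normal_pdf 0 1 z.
pose F (z : R) := z * normal_pdf 0 1 z.
have ip := @integrable_normal_pdf R 0 1.
have ig : lebesgue_measure.-integrable setT (EFin \o g).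
  exact: (integrableB measurableT ip (@integrable_sqr_normal_pdf R)).
have dF (z : R) : is_derive z (1 : R) F (g z).
  have h := is_derive_normal_pdf01 z.
  by rewrite /F; apply: is_derive_eq; rewrite /GRing.scale/= /g; ring.
have cF : continuous F.
  by move=> z; apply: differentiable_continuous; apply/derivable1_diffP; have [] := dF z.
have cp : continuous (normal_pdf (0:R) 1).
  by apply: continuous_normal_pdf; rewrite oner_eq0.
have cg : continuous g.
  move=> z; apply: cvgB; first exact: cp.
  by apply: cvgM; [exact: sqr_continuous|exact: cp].
have FTC (n : nat) :
  (\int[lebesgue_measure]_(z in `[(- n.+1%:R)%R, (n.+1%:R)%R]) (g z)%:E =
   (2 * F n.+1%:R)%:E)%E.
  rewrite (continuous_FTC2 (F := F)).
  - rewrite -EFinB; congr EFin; rewrite /F !normal_pdf01E sqrrN; ring.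
  - by rewrite -subr_gt0 opprK addr_gt0.
  - exact: continuous_subspaceT.
  - split; [by move=> x _; have [] := dF x|..].
    + by apply: cvg_at_right_filter; exact: cF.
    + by apply: cvg_at_left_filter; exact: cF.
  - by move=> x _; rewrite derive1E; have [] := dF x.
have lim0 : (2 * F n.+1%:R)%:E @[n --> \oo] --> 0%E.
  apply: cvg_EFin; first exact: nearW.
  (* Since z^2 <= 2 exp(z^2 / 2), one has z phi(z) <= 2 phi(0) / z; this is used at z = n + 1. *)
  apply: (@squeeze_cvgr _ _ _ _ (fun=> 0) (fun n => (4 * normal_peak 1) * harmonic n)).
  - apply: nearW => n; rewrite mulr_ge0 ?mulr_ge0 ?normal_pdf_ge0//=.
    rewrite /F -ler_pdivlMl// /harmonic normal_pdf01E.
    rewrite -(ler_pM2l (x := n.+1%:R))//.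
    have -> : n.+1%:R * (2^-1 * (4 * normal_peak 1 / n.+1%:R)) = 2 * normal_peak 1 :> R.
      by field; rewrite lt0r_neq0.
    have -> : n.+1%:R * (n.+1%:R * (normal_peak 1 * expR (- n.+1%:R ^+ 2 / 2))) =
       normal_peak 1 * (n.+1%:R ^+ 2 * expR (- n.+1%:R ^+ 2 / 2)) :> R by ring.
    rewrite [2 * _]mulrC ler_wpM2l ?normal_peak_ge0// mulNr expRN.
    rewrite ler_pdivrMr ?expR_gt0//.
    have := expR_ge1Dx (n.+1%:R ^+ 2 / 2 : R); lra.
  - exact: cvg_cst.
  - rewrite -(mulr0 (4 * normal_peak 1)); apply: cvgMr; exact: cvg_harmonic.
have int0 : (\int[lebesgue_measure]_z (g z)%:E = 0)%E.
  pose gn (n : nat) := (EFin \o g) \_ `[- n.+1%:R, n.+1%:R].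
  have : (\int[lebesgue_measure]_z gn n z)%E @[n --> \oo] -->
      (\int[lebesgue_measure]_z (g z)%:E)%E.
    apply: (@dominated_cvg _ _ _ lebesgue_measure _ measurableT gn (EFin \o g)
      (abse \o (EFin \o g))) => //.
    - move=> n; apply/(measurable_restrictT _ _).1 => //.
      by apply: measurable_funTS; exact: measurable_int ig.
    - move=> z _; apply: cvg_near_cst.
      exists (Num.truncn `|z|).+1 => // n /= nz.
      rewrite /gn patchE ifT// inE/= in_itv/= -ler_norml.
      apply: ltW; apply: lt_le_trans (truncnS_gt _) _.
      by rewrite ler_nat; apply: leq_trans nz _.
    - exact: integrable_abse.
    - move=> n z _; rewrite /gn patchE; case: ifP => // _.
      by rewrite abse0 abse_ge0.
  move=> h; apply: (cvg_unique _ h) => //.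
  rewrite (_ : (fun n => _) = (fun n => (2 * F n.+1%:R)%:E))//.
  by apply/funext => n; rewrite /gn -integral_mkcond FTC.
move: int0; rewrite /g.
under eq_integral do rewrite EFinB.
rewrite integralB//; last exact: integrable_sqr_normal_pdf.
rewrite integral_normal_pdf.
have := integrable_fin_num measurableT (@integrable_sqr_normal_pdf R).
case: (X in X \is a _) => // r _ /= [] /eqP.
by rewrite subr_eq0 => /eqP <-.
Qed.

Lemma second_moment_normal (R : realType) :
  (\int[normal_prob (0 : R) 1]_z (z ^+ 2)%:E = 1)%E.
Proof.
rewrite ge0_integral_normal_prob.
- exact: lebesgue_second_moment_normal.
- by apply/measurable_EFinP; apply: measurable_funX; exact: measurable_id.
- by move=> x; rewrite lee_fin sqr_ge0.
Qed.

Lemma Lfun2_normal (R : realType) :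
  (id : measurableTypeR R -> R) \in Lfun (normal_prob (0 : R) 1) 2%:E.
Proof.
rewrite inE; apply/andP; split; rewrite inE/=; first exact: measurable_id.
rewrite /finite_norm unlock /Lnorm poweR_lty//=.
under eq_integral => x _ do rewrite powR_mulrn// real_normK ?num_real//.
by rewrite second_moment_normal ltry.
Qed.

(** The variables z and -z have the same law, so the mean is its own opposite; it is finite by
    square integrability, hence 0. *)
Lemma mean_normal (R : realType) :
  (\int[normal_prob (0 : R) 1]_z z%:E = 0)%E.
Proof.
have i1 : (normal_prob (0 : R) 1).-integrable setT (EFin \o id).
  apply/Lfun1_integrable; apply: Lfun_subset12; last exact: Lfun2_normal.
  exact: fin_num_measure.
have mf : @measurable_fun _ _ (measurableTypeR R) (measurableTypeR R) setT
    (fun z : R => - z) by exact: measurable_funN.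
have : (\int[normal_prob (0 : R) 1]_z z%:E =
        \int[normal_prob (0 : R) 1]_z (- z)%:E)%E.
  transitivity (\int[distribution (normal_prob (0:R) 1) (real_mfun mf)]_z z%:E)%E.
    apply: eq_measure_integral => A mA _.
    exact/esym/normal_prob_sym.
  rewrite integral_distribution//.
  have := integrableN i1.
  by apply: eq_integrable.
under [X in _ = X -> _]eq_integral do rewrite EFinN.
rewrite integralN//; last exact: integrable_add_def.
have := integrable_fin_num measurableT i1.
case: (X in X \is a _) => //= r _ => -[] /eqP.
by rewrite -addr_eq0 -mulr2n mulrn_eq0/= => /eqP ->.
Qed.

(** * Sums of independent normal variables *)

(** Bayes' formula, by completing the square: x is standard normal and, given x, u is normal with
    mean s1 x and deviation s2. The right side is the marginal of u times the conditional density of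
    x given u, so integrating x out only uses that a density has mass 1. *)
Lemma normal_pdf_conv (R : realType) (s1 s2 x u : R) : 0 < s1 -> 0 < s2 ->
  normal_pdf (s1 * x) s2 u * normal_pdf 0 1 x =
  normal_pdf 0 (Num.sqrt (s1 ^+ 2 + s2 ^+ 2)) u *
  normal_pdf (s1 * u / (s1 ^+ 2 + s2 ^+ 2))
    (s2 / Num.sqrt (s1 ^+ 2 + s2 ^+ 2)) x.
Proof.
move=> s10 s20; set t := s1 ^+ 2 + s2 ^+ 2.
have t0 : 0 < t by rewrite addr_gt0 ?exprn_gt0.
have st0 : 0 < Num.sqrt t by rewrite sqrtr_gt0.
have stE : Num.sqrt t ^+ 2 = t by rewrite sqr_sqrtr// ltW.
have peakE (s : R) : 0 < s -> normal_peak s = s^-1 * (Num.sqrt (pi *+ 2))^-1.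
  move=> s0; rewrite /normal_peak -mulrnAr sqrtrM ?sqr_ge0//.
  by rewrite sqrtr_sqr gtr0_norm// invfM.
rewrite !normal_pdfE ?gt_eqF ?divr_gt0//.
rewrite !peakE ?divr_gt0// /normal_fun.
rewrite mulrACA -expRD [RHS]mulrACA -expRD; congr (_ * expR _).
  by rewrite invf_div; field; rewrite ?gt_eqF// sqrtr_gt0 mulrn_wgt0// pi_gt0.
rewrite expr_div_n stE /t.
by field; rewrite -/t !gt_eqF.
Qed.

(** Convolution of centered normal laws. A zero scale is settled directly, since the computation
    with densities requires both to be positive. *)
Lemma normal_conv (R : realType) (s1 s2 : R) (B : set R) :
  0 <= s1 -> 0 <= s2 -> measurable B ->
  (\int[normal_prob (0 : R) 1]_x
     normal_prob (0 : R) 1 [set y | B (s1 * x + s2 * y)%R] =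
   normal_prob (0 : R) 1 [set z | B (0 + Num.sqrt (s1 ^+ 2 + s2 ^+ 2) * z)%R])%E.
Proof.
rewrite le_eqVlt => /predU1P[<- s20 mB|s10].
  rewrite expr0n/= add0r sqrtr_sqr ger0_norm//.
  under eq_integral do rewrite mul0r.
  by rewrite integral_cst// [X in (_ * X)%E]probability_setT mule1.
rewrite le_eqVlt => /predU1P[<- mB|s20 mB].
  rewrite expr0n/= addr0 sqrtr_sqr gtr0_norm//.
  have mB' : measurable [set z : R | B (0 + s1 * z)].
    have := @measurable_affine R 0 s1 measurableT _ mB.
    by rewrite setTI.
  transitivity (\int[normal_prob (0 : R) 1]_x
    (\1_[set z | B (0 + s1 * z)%R] x)%:E)%E; last first.
    by rewrite integral_indic ?setIT.
  apply: eq_integral => x _.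
  under eq_fun do rewrite mul0r addr0.
  rewrite indicE; case: (asboolP (B (0 + s1 * x))) => h.
    rewrite mem_set//.
    have -> : [set _ : R | B (s1 * x)] = setT.
      by apply/seteqP; split => // y _ /=; rewrite -[_ * _]add0r.
    by rewrite [LHS]probability_setT.
  rewrite memNset//.
  have -> : [set _ : R | B (s1 * x)] = set0.
    by apply/seteqP; split => // y /=; rewrite -[_ * _]add0r.
  by rewrite measure0.
set s := Num.sqrt _.
have s0 : 0 < s by rewrite sqrtr_gt0 addr_gt0 ?exprn_gt0.
rewrite -(normal_prob_affine 0 s0 mB).
(* The joint density of (x, u) with u = s1 x + s2 y, cut to u in [B]. Integrating over u leads to
   the left side, over x to the right side, and Tonelli equates them. *)
pose f (xu : measurableTypeR R * measurableTypeR R) : \bar R :=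
  (\1_B xu.2 * (normal_pdf (s1 * xu.1) s2 xu.2 * normal_pdf 0 1 xu.1))%:E.
have mpdf2 : @measurable_fun _ _
    (measurableTypeR R * measurableTypeR R)%type (measurableTypeR R) setT
    (fun xu => normal_pdf (s1 * xu.1) s2 xu.2).
  rewrite (_ : (fun _ => _) = (fun xu => normal_peak s2 *
     expR ((- (xu.2 - s1 * xu.1) ^+ 2) / (s2 ^+ 2 *+ 2)))); last first.
    by apply/funext => xu; rewrite normal_pdfE// gt_eqF.
  apply: measurable_funM => //; apply: measurableT_comp => //.
  apply: measurable_funM => //; apply: measurableT_comp => //.
  apply: measurable_funX => //; apply: measurable_funB => //.
  by apply: measurable_funM => //.
have mf : measurable_fun setT f.
  apply/measurable_EFinP/measurable_funM.
    by apply: measurableT_comp => //; exact: measurable_indic.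
  apply: measurable_funM => //.
  by apply: (measurableT_comp (measurable_normal_pdf _ _)).
have f0 z : (0 <= f z)%E.
  by rewrite lee_fin mulr_ge0// ?mulr_ge0 ?normal_pdf_ge0.
have fE1 (x : R) : (\int[lebesgue_measure]_u f (x, u) =
    normal_prob (0 : R) 1 [set y | B (s1 * x + s2 * y)%R] * (normal_pdf 0 1 x)%:E)%E.
  rewrite -(normal_prob_affine (s1 * x) s20 mB) /normal_prob.
  rewrite -ge0_integralZr//; last 3 first.
  - by apply/measurable_EFinP/measurable_funTS; exact: measurable_normal_pdf.
  - by move=> u _; rewrite lee_fin normal_pdf_ge0.
  - by rewrite lee_fin normal_pdf_ge0.
  rewrite [RHS]integral_mkcond; apply: eq_integral => u _.
  rewrite patchE /f/= indicE; case: (u \in B).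
    by rewrite mul1r EFinM.
  by rewrite mul0r.
have fE2 (u : R) : (\int[lebesgue_measure]_x f (x, u) =
    (\1_B u * normal_pdf 0 s u)%:E)%E.
  under eq_integral => x _.
    rewrite /f/= normal_pdf_conv// -/s mulrA EFinM.
    over.
  rewrite ge0_integralZl//; last 3 first.
  - by apply/measurable_EFinP; exact: measurable_normal_pdf.
  - by move=> x _; rewrite lee_fin normal_pdf_ge0.
  - by rewrite lee_fin mulr_ge0// normal_pdf_ge0.
  by rewrite integral_normal_pdf mule1.
rewrite ge0_integral_normal_prob//; last first.
  rewrite (_ : (fun x => _) = (fun x => (\int[lebesgue_measure]_u
     (\1_B u * normal_pdf (s1 * x) s2 u)%:E)%E)).
    apply: (measurable_fun_fubini_tonelli_F
      (fun xu : measurableTypeR R * measurableTypeR R =>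
        (\1_B xu.2 * normal_pdf (s1 * xu.1) s2 xu.2)%:E)).
      apply/measurable_EFinP/measurable_funM => //.
      by apply: measurableT_comp => //; exact: measurable_indic.
    by move=> z; rewrite lee_fin mulr_ge0// normal_pdf_ge0.
  apply/funext => x; rewrite -(normal_prob_affine (s1 * x) s20 mB) /normal_prob.
  rewrite [LHS]integral_mkcond; apply: eq_integral => u _.
  rewrite patchE /= indicE; case: (u \in B).
    by rewrite mul1r.
  by rewrite mul0r.
under eq_integral do rewrite -fE1.
rewrite fubini_tonelli//.
under eq_integral do rewrite fE2.
rewrite /normal_prob [RHS]integral_mkcond; apply: eq_integral => u _.
rewrite patchE indicE; case: (u \in B).
  by rewrite mul1r.
by rewrite mul0r.
Qed.

(** The event [A] is carried along so that the lemma can be iterated on a growing sum while later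
    variables remain in play. Conditionally on [A] the pair (X, Y) has a product law and the sum has
    the convolution law; when [A] is null both sides vanish. *)
Lemma normal_law_add_independent d (T : measurableType d) (R : realType)
    (P : probability T R) (X Y : T -> R) (s1 s2 : R) (A : set T) :
  measurable_fun setT X -> measurable_fun setT Y -> measurable A ->
  0 <= s1 -> 0 <= s2 ->
  (forall B C : set R, measurable B -> measurable C ->
    P (X @^-1` B `&` Y @^-1` C `&` A) =
    (normal_prob (0 : R) 1 [set z | B (0 + s1 * z)%R] *
     normal_prob (0 : R) 1 [set z | C (0 + s2 * z)%R] * P A)%E) ->
  forall B, measurable B ->
    P ((fun w => X w + Y w) @^-1` B `&` A) =
    (normal_prob (0 : R) 1 [set z | B (0 + Num.sqrt (s1 ^+ 2 + s2 ^+ 2) * z)%R]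
     * P A)%E.
Proof.
move=> mX mY mA s10 s20 XY B mB.
have mS : measurable ((fun w => X w + Y w) @^-1` B).
  by rewrite -[X in measurable X]setTI; apply: measurable_funD.
have [PA0|PA0] := eqVneq (P A) 0%E.
  rewrite PA0 mule0; apply/eqP; rewrite -measure_le0 -PA0.
  by apply: le_measure; rewrite ?inE//; exact: measurableI.
have qfin : P A \is a fin_num by exact: fin_num_measure.
pose q := fine (P A).
have qE : P A = q%:E by rewrite fineK.
have q0 : 0 < q.
  by rewrite fine_gt0// -ge0_fin_numE// qfin andbT lt0e PA0 measure_ge0.
pose qi : {nonneg R} := NngNum (ltW (eq_ind_r (fun x => is_true x) q0 (invr_gt0 q))).
pose m1 : probability _ R := distribution (normal_prob (0:R) 1)
  (real_mfun (measurable_affine 0 s1)).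
pose m2 : probability _ R := distribution (normal_prob (0:R) 1)
  (real_mfun (measurable_affine 0 s2)).
have mXY : measurable_fun setT
    (fun w => (X w, Y w) : measurableTypeR R * measurableTypeR R).
  exact/measurable_fun_pairP.
(* The joint law of (X, Y) given [A]: restrict [P] to [A], push forward, divide by P(A). *)
pose m' := mscale qi
  (measure_function_pushforward__canonical__measure_function_Measure
    (mrestr P mA) mXY).
pose S : set (measurableTypeR R * measurableTypeR R) := [set xy | B (xy.1 + xy.2)].
have mS' : measurable S.
  rewrite -[X in measurable X]setTI.
  suff : @measurable_fun _ _
      (measurableTypeR R * measurableTypeR R)%type (measurableTypeR R) setT
      (fun xy => xy.1 + xy.2) by apply.
  exact: measurable_funD.
have h : (m1 \x m2)%E S = m' S.
  apply: product_measure_unique => // B1 B2 mB1 mB2.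
  transitivity ((q^-1)%:E * P (X @^-1` B1 `&` Y @^-1` B2 `&` A))%E => //.
  by rewrite XY// qE muleC -muleA -EFinM divff ?gt_eqF// mule1.
have m'S : P ((fun w => X w + Y w) @^-1` B `&` A) = (q%:E * m' S)%E.
  transitivity (q%:E * ((q^-1)%:E *
    P ((fun w => (X w + Y w)%R) @^-1` B `&` A)))%E => //.
  by rewrite muleA -EFinM divff ?gt_eqF// mul1e.
rewrite m'S -h muleC qE; congr (_ * _)%E.
rewrite -(normal_conv s10 s20 mB).
rewrite /product_measure1/= [LHS]ge0_integral_distribution//; last first.
  exact: (@measurable_fun_xsection _ _ _ _ _ m2 S mS').
apply: eq_integral => x _ /=.
rewrite /xsection/= /distribution /pushforward/=.
by congr (normal_prob _ _ _); apply/seteqP; split => z /=;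
  rewrite ?inE /S/= !add0r.
Qed.

(** * Laws tested by continuous functions, and limits of normal laws *)

(** The exponent is minus the positive part of x - a, so the function is 0 up to [a] and increases
    to 1 with [k] beyond [a]: a continuous approximation of the indicator of the open ray. *)
Definition ray_approx (R : realType) (a : R) (k : nat) (x : R) : R :=
  1 - expR (- ((`|x - a| + (x - a)) / 2)) ^+ k.

Lemma ray_approx01 (R : realType) (a : R) k x : 0 <= ray_approx a k x <= 1.
Proof.
have h : 0 <= expR (- ((`|x - a| + (x - a)) / 2)) <= 1.
  rewrite expR_ge0 -[leRHS]expR0 ler_expR lerNl oppr0.
  have := ler_norm (- (x - a)); rewrite normrN; lra.
have [h0 h1] := andP h.
have : expR (- ((`|x - a| + (x - a)) / 2)) ^+ k <= 1 by rewrite exprn_ile1.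
have : 0 <= expR (- ((`|x - a| + (x - a)) / 2)) ^+ k by rewrite exprn_ge0.
by rewrite /ray_approx; lra.
Qed.

Lemma continuous_ray_approx (R : realType) (a : R) k :
  continuous (ray_approx a k).
Proof.
move=> x; apply: cvgB; first exact: cvg_cst.
apply: (cvg_comp _ (fun y : R => y ^+ k)); last exact: exprn_continuous.
apply: (cvg_comp _ expR); last exact: continuous_expR.
have c1 : (fun x => x - a) @ x --> x - a by apply: cvgB; [exact: cvg_id|exact: cvg_cst].
apply: cvgN; apply: cvgM; last exact: cvg_cst.
by apply: cvgD => //; apply: cvg_norm.
Qed.

Lemma cvg_ray_approx (R : realType) (a : R) (x : R) :
  ray_approx a k x @[k --> \oo] --> (\1_(`]a, +oo[%classic) x : R).
Proof.
rewrite indicE; have [ax|xa] := ltP a x.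
  rewrite mem_set/= ?in_itv/= ?ax// -[X in _ --> X]subr0.
  apply: cvgB; first exact: cvg_cst.
  apply: cvg_expr; rewrite ger0_norm ?expR_ge0// -[ltRHS]expR0 ltr_expR.
  by rewrite gtr0_norm ?subr_gt0//; lra.
rewrite memNset/= ?in_itv/= ?andbT; last by apply/negP; rewrite -leNgt.
rewrite (_ : (fun k => _) = fun=> 0); first exact: cvg_cst.
apply/funext => k; rewrite /ray_approx ler0_norm ?subr_le0//.
by rewrite addNr mul0r oppr0 expR0 expr1n subrr.
Qed.

Section laws.
Context d (T : measurableType d) (R : realType) (P : probability T R).

Lemma integrable_bounded_comp (X : T -> R) (f : R -> R) :
  measurable_fun setT X -> continuous f -> (forall x, 0 <= f x <= 1) ->
  P.-integrable setT (fun w => (f (X w))%:E).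
Proof.
move=> mX cf f01.
apply: (@le_integrable _ _ _ P _ measurableT _ (EFin \o cst 1)).
- apply/measurable_EFinP/measurableT_comp => //.
  exact: continuous_measurable_fun.
- move=> w _; rewrite !abse_EFin lee_fin normr1.
  by have /andP[? ?] := f01 (X w); rewrite ger0_norm.
- exact: finite_measure_integrable_cst.
Qed.

Lemma cvg_integral_ray_approx (X : T -> R) (a : R) : measurable_fun setT X ->
  (\int[P]_w (ray_approx a k (X w))%:E)%E @[k --> \oo] --> P (X @^-1` `]a, +oo[).
Proof.
move=> mX.
have mA : measurable (X @^-1` `]a, +oo[).
  by rewrite -[X in measurable X]setTI; apply: mX.
rewrite -[X in P X]setIT -(integral_indic P measurableT mA).
apply: (@dominated_cvg _ _ _ P _ measurableT (fun k w => (ray_approx a k (X w))%:E)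
  (fun w => (\1_(X @^-1` `]a, +oo[) w)%:E) (EFin \o cst 1)) => //.
- move=> k; apply/measurable_EFinP/measurableT_comp => //.
  by apply: continuous_measurable_fun; exact: continuous_ray_approx.
- move=> w _; apply: cvg_EFin; first exact: nearW.
  exact: cvg_ray_approx.
- exact: finite_measure_integrable_cst.
- move=> k w _; rewrite abse_EFin lee_fin.
  by have /andP[? ?] := ray_approx01 a k (X w); rewrite ger0_norm.
Qed.

End laws.

(** Open rays determine a law, and their indicators are pointwise limits of continuous functions
    with values in [0, 1], so dominated convergence transfers the equality. *)
Lemma eq_law_continuous d (T : measurableType d) d' (T' : measurableType d')
    (R : realType) (P : probability T R) (Q : probability T' R)
    (X : T -> R) (Y : T' -> R) :
  measurable_fun setT X -> measurable_fun setT Y ->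
  (forall f : R -> R, continuous f -> (forall x, 0 <= f x <= 1) ->
    (\int[P]_w (f (X w))%:E = \int[Q]_w (f (Y w))%:E)%E) ->
  forall B : set R, measurable B -> P (X @^-1` B) = Q (Y @^-1` B).
Proof.
move=> mX mY XY B mB.
pose X' : {mfun T >-> measurableTypeR R} := real_mfun
  mX.
pose Y' : {mfun T' >-> measurableTypeR R} := real_mfun
  mY.
suff : distribution P X' B = distribution Q Y' B by [].
apply: eq_measure_rays => //.
  by rewrite -ge0_fin_numE// fin_num_measure.
move=> a.
suff : P (X @^-1` `]a, +oo[) = Q (Y @^-1` `]a, +oo[) by [].
have h1 := @cvg_integral_ray_approx _ _ _ P X a mX.
have h2 := @cvg_integral_ray_approx _ _ _ Q Y a mY.
apply: (cvg_unique _ h1) => //.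
rewrite (_ : (fun k => _) = fun k => (\int[Q]_w (ray_approx a k (Y w))%:E)%E)//.
apply/funext => k; apply: XY; first exact: continuous_ray_approx.
exact: ray_approx01.
Qed.

Section normal_laws.
Context d (T : measurableType d) (R : realType) (P : probability T R).
Implicit Types (X Y : T -> R) (m s : R).

Lemma ge0_integral_normal_law X m s (f : R -> \bar R) :
  has_normal_law P X m s -> measurable_fun setT f -> (forall x, 0 <= f x)%E ->
  (\int[P]_w f (X w) = \int[normal_prob (0 : R) 1]_z f (m + s * z)%R)%E.
Proof.
move=> [mX XE] mf f0.
pose X' : {mfun T >-> measurableTypeR R} := real_mfun
  mX.
pose Z' : {mfun measurableTypeR R >-> measurableTypeR R} := real_mfun
  (measurable_affine m s).
transitivity (\int[distribution P X']_y f y)%E.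
  exact/esym/ge0_integral_distribution.
transitivity (\int[distribution (normal_prob (0 : R) 1) Z']_y f y)%E.
  by apply: eq_measure_integral => A mA _; exact: XE.
exact: ge0_integral_distribution.
Qed.

Lemma normal_law_continuous X m s (f : R -> R) :
  has_normal_law P X m s -> continuous f -> (forall x, 0 <= f x <= 1) ->
  (\int[P]_w (f (X w))%:E =
   \int[normal_prob (0 : R) 1]_z (f (m + s * z)%R)%:E)%E.
Proof.
move=> X_law cf f01; apply: (ge0_integral_normal_law (f := EFin \o f)) => //.
- by apply/measurable_EFinP; exact: continuous_measurable_fun.
- by move=> x; rewrite lee_fin; have /andP[] := f01 x.
Qed.

Lemma continuous_integral_normal m (s0 : R) (f : R -> R) :
  continuous f -> (forall x, 0 <= f x <= 1) ->
  {for s0, continuous (fun s => \int[normal_prob (0 : R) 1]_z f (m + s * z))}.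
Proof.
move=> cf f01.
have mf := continuous_measurable_fun cf.
have := @continuity_under_integral R _ _ (normal_prob (0 : R) 1)
  (fun s z => f (m + s * z)) setT measurableT (s0 - 1) (s0 + 1).
move=> /(_ _ _ (cst 1)); apply.
- move=> s _.
  apply: (integrable_bounded_comp (normal_prob (0 : R) 1)
    (X := fun z => m + s * z)) => //.
  exact: measurable_affine.
- apply: aeW => z _ s _; apply: continuous_comp; last exact: cf.
  by apply: cvgD; [exact: cvg_cst|apply: cvgM; [exact: cvg_id|exact: cvg_cst]].
- exact: finite_measure_integrable_cst.
- move=> s _; apply: aeW => z _ /=.
  by have /andP[? ?] := f01 (m + s * z); rewrite ger0_norm.
- by rewrite inE/= in_itv/=; apply/andP; split; lra.
Qed.

(** For continuous [f] with values in [0, 1], the mean of f(X_n) is a continuous function [h] of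
    s_n, and it converges to the mean of f(Y); at a cluster point [h] must take this limit value. *)
Lemma normal_law_limit (X_ : nat -> T -> R) Y m (s : nat -> R) (s0 : R) :
  (forall n, has_normal_law P (X_ n) m (s n)) -> measurable_fun setT Y ->
  {ae P, forall w, X_ n w @[n --> \oo] --> Y w} ->
  cluster (s @ \oo) s0 -> has_normal_law P Y m s0.
Proof.
move=> X_law mY XY cl; split => // B mB.
apply: (@eq_law_continuous _ _ _ _ _ P (normal_prob (0 : R) 1) Y
  (fun z => m + s0 * z)) => //.
  exact: measurable_affine.
move=> f cf f01.
have mf := continuous_measurable_fun cf.
have iY := integrable_bounded_comp P mY cf f01.
have iZ := integrable_bounded_comp (normal_prob (0 : R) 1)
  (measurable_affine m s0)
  cf f01.
rewrite -(fineK (integrable_fin_num measurableT iY)).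
rewrite -(fineK (integrable_fin_num measurableT iZ)).
congr EFin.
set e := fine _; set h0 := fine _.
pose h (t : R) : R := \int[normal_prob (0 : R) 1]_z f (m + t * z).
have ch : h @ s0 --> h0 := @continuous_integral_normal m s0 f cf f01.
have ce : h (s n) @[n --> \oo] --> e.
  have fX : {ae P, forall w, setT w ->
      (f (X_ n w))%:E @[n --> \oo] --> (f (Y w))%:E}.
    apply: filterS XY => w Xw _; apply: cvg_EFin; first exact: nearW.
    exact: (cvg_comp _ f Xw (cf _)).
  have dom : {ae P, forall w n, setT w -> (`|(f (X_ n w))%:E| <= 1%:E)%E}.
    apply: aeW => w n _; rewrite abse_EFin lee_fin.
    by have /andP[? ?] := f01 (X_ n w); rewrite ger0_norm.
  have [_ _ +] := dominated_convergence measurableT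
    (fun n => measurable_int _ (integrable_bounded_comp P (X_law n).1 cf f01))
    (measurable_int _ iY) fX
    (finite_measure_integrable_cst P 1 measurableT) dom.
  rewrite -(fineK (integrable_fin_num measurableT iY)) => /fine_cvg.
  apply: cvg_trans; rewrite (_ : fine \o _ = (fun n => h (s n)))//.
  apply/funext => n /=; rewrite /h /Rintegral; congr fine.
  exact: (normal_law_continuous (X_law n)).
apply/eqP; rewrite -subr_eq0 -normr_eq0 eq_le normr_ge0 andbT.
apply/ler_addgt0Pr => eps eps0; rewrite add0r.
have eps20 : 0 < eps / 2 by rewrite divr_gt0.
(* The first set eventually contains the sequence, the second is a neighbourhood of [s0]; clustering
   gives them a common point [t]. *)
have := cl (fun t => `|e - h t| < eps / 2) (fun t => `|h0 - h t| < eps / 2).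
case=> [||t [/= h1 h2]].
- by move/cvgrPdist_lt : ce => /(_ _ eps20).
- by move/cvgrPdist_lt : ch => /(_ _ eps20).
have -> : e - h0 = (e - h t) - (h0 - h t) by ring.
apply: (le_trans (ler_normB _ _)).
by rewrite [leRHS](splitr eps) lerD// ltW.
Qed.


Lemma normal_law_rv X m s : 0 <= s -> has_normal_law P X m s -> normal_rv P X.
Proof.
move=> s0 [mX XE]; split => //; exists m, s; split => // B mB.
rewrite XE//; have [->|sn0] := eqVneq s 0; last first.
  by rewrite -normal_prob_affine// lt0r sn0.
rewrite diracE; case: (asboolP (B m)) => Bm.
  rewrite mem_set// (_ : [set z | _] = setT) ?probability_setT//.
  by apply/seteqP; split => // z _ /=; rewrite mul0r addr0.
rewrite memNset// (_ : [set z | _] = set0) ?measure0//.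
by apply/seteqP; split => // z /=; rewrite mul0r addr0.
Qed.

Lemma normal_rv_law X : normal_rv P X ->
  exists m s : R, 0 <= s /\ has_normal_law P X m s.
Proof.
move=> [mX [m [s [s0 XE]]]]; exists m, s; split => //; split => // B mB.
rewrite XE//; have [->|sn0] := eqVneq s 0; last first.
  by rewrite normal_prob_affine// lt0r sn0.
rewrite diracE; case: (asboolP (B m)) => Bm.
  rewrite mem_set// (_ : [set z | _] = setT) ?probability_setT//.
  by apply/seteqP; split => // z _ /=; rewrite mul0r addr0.
rewrite memNset// (_ : [set z | _] = set0) ?measure0//.
by apply/seteqP; split => // z /=; rewrite mul0r addr0.
Qed.

Lemma normal_lawD_cst X m s c : has_normal_law P X m s ->
  has_normal_law P (fun w => c + X w) (c + m) s.
Proof.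
move=> [mX XE]; split; first exact: measurable_funD.
move=> B mB.
have mB' : measurable [set x : R | B (c + x)].
  have mc : measurable_fun setT (fun x : R => c + x).
    by apply: measurable_funD => //; exact: measurable_id.
  by have := mc measurableT _ mB; rewrite setTI.
rewrite -[LHS]/(P (X @^-1` [set x : R | B (c + x)])) XE//.
by congr (normal_prob _ _ _); apply/seteqP; split => z /=; rewrite addrA.
Qed.

Let affine_Lfun2 m s :
  ((fun z => m + s * z) : measurableTypeR R -> R) \in Lfun (normal_prob (0 : R) 1) 2%:E.
Proof.
rewrite (_ : (fun z => _) = (cst m \+ (s \o* id) : measurableTypeR R -> R)); last first.
  by apply/funext => z /=; rewrite mulrC.
have h1 := Lfun_cst (normal_prob (0 : R) 1) m 2.
have h2 : (s \o* id : measurableTypeR R -> R) \in Lfun (normal_prob (0 : R) 1) 2%:E.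
  by apply: Lfun_scale; [rewrite ler1n|exact: Lfun2_normal].
by rewrite rpredD ?lee1n//=.
Qed.

Lemma normal_law_Lfun2 X m s : has_normal_law P X m s -> X \in Lfun P 2%:E.
Proof.
move=> X_law; have [mX _] := X_law.
rewrite inE; apply/andP; split; rewrite inE//=.
rewrite /finite_norm unlock /Lnorm poweR_lty//=.
under eq_integral => x _ do rewrite powR_mulrn// real_normK ?num_real//.
rewrite (ge0_integral_normal_law (f := fun x => (x ^+ 2)%:E) X_law).
- have /Lfun2_integrable_sqr := affine_Lfun2 m s.
  exact: integrable_lty.
- by apply/measurable_EFinP; apply: measurable_funX; exact: measurable_id.
- by move=> x; rewrite lee_fin sqr_ge0.
Qed.

Lemma normal_law_expectation X m s : has_normal_law P X m s -> ('E_P[X] = m%:E)%E.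
Proof.
move=> X_law; have [mX XE] := X_law.
have Pfin : P setT \is a fin_num := fin_num_measure P _ measurableT.
have Nfin : normal_prob (0 : R) 1 setT \is a fin_num :=
  fin_num_measure (normal_prob (0 : R) 1) _ measurableT.
have X1 := Lfun_subset12 Pfin (normal_law_Lfun2 X_law).
pose X' : {mfun T >-> measurableTypeR R} := real_mfun
  mX.
pose Z' : {mfun measurableTypeR R >-> measurableTypeR R} := real_mfun
  (measurable_affine m s).
have mE : measurable_fun setT (EFin : measurableTypeR R -> \bar R).
  by apply/measurable_EFinP; exact: measurable_id.
transitivity (\int[distribution P X']_y y%:E)%E.
  rewrite integral_distribution// ?expectation.unlock//.
  by apply/Lfun1_integrable.
transitivity (\int[distribution (normal_prob (0 : R) 1) Z']_y y%:E)%E.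
  by apply: eq_measure_integral => A mA _; exact: XE.
have Z1 := Lfun_subset12 Nfin (affine_Lfun2 m s).
rewrite integral_distribution//; last by apply/Lfun1_integrable.
transitivity ('E_(normal_prob (0 : R) 1)
  [(cst m \+ (s \o* id) : measurableTypeR R -> R)])%E.
  rewrite expectation.unlock; apply: eq_integral => z _ /=; by rewrite mulrC.
have I1 := Lfun_subset12 Nfin (@Lfun2_normal R).
rewrite expectationD//=; last 2 first.
- exact: Lfun_cst.
- exact: Lfun_scale.
rewrite expectation_cst expectationZl//.
by rewrite [X in (_ * X)%E](_ : _ = 0%E) ?mule0 ?adde0// expectation.unlock mean_normal.
Qed.

Lemma normal_law_variance X m s : has_normal_law P X m s ->
  ('V_P[X] = (s ^+ 2)%:E)%E.
Proof.
move=> X_law; have XE := normal_law_expectation X_law.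
rewrite /variance covariance.unlock XE expectation.unlock.
rewrite (ge0_integral_normal_law (f := fun x => ((x - m) * (x - m))%:E) X_law).
- under eq_integral => z _.
    rewrite (_ : (m + s * z - m) * (m + s * z - m) = s ^+ 2 * z ^+ 2); last by ring.
    rewrite EFinM.
    over.
  rewrite ge0_integralZl//.
  + by rewrite second_moment_normal mule1.
  + by apply/measurable_EFinP; apply: measurable_funX; exact: measurable_id.
  + by move=> z _; rewrite lee_fin sqr_ge0.
  + by rewrite lee_fin sqr_ge0.
- apply/measurable_EFinP; apply: measurable_funM; apply: measurable_funB => //;
  exact: measurable_id.
- by move=> x; rewrite lee_fin -expr2 sqr_ge0.
Qed.

End normal_laws.

(** * Riemann sums and the pathwise solution *)

Section integral_continuous.
Context {R : realType}.
Implicit Types (f g X B : R -> R) (t d : R).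

Notation mu := (@lebesgue_measure R).

Lemma integrable_continuous_itv f a b : continuous f ->
  mu.-integrable `[a, b] (EFin \o f).
Proof.
move=> cf; apply: continuous_compact_integrable; first exact: segment_compact.
exact: continuous_subspaceT.
Qed.

Lemma is_derive_integral0 f t : continuous f -> 0 < t ->
  is_derive t 1 (fun t => \int[mu]_(u in `[0, t]) f u) (f t).
Proof.
move=> cf t0.
have tt1 : t < t + 1 by rewrite ltrDl.
have [df dfE] := continuous_FTC1_closed tt1
  (integrable_continuous_itv 0 (t + 1) cf) t0 (cf t).
by split => //; rewrite -derive1E dfE.
Qed.

Lemma continuous_integral0 f a b d : continuous f -> 0 <= a -> b <= d ->
  {within `[a, b], continuous (fun t => \int[mu]_(u in `[0, t]) f u)}.
Proof.
move=> cf a0 bd; have [ab|ba] := leP a b; last first.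
  rewrite set_itv_ge; last by rewrite bnd_simp -ltNge.
  exact: continuous_subspace0.
have d0 : 0 <= d by rewrite (le_trans a0)// (le_trans ab).
apply: (@continuous_subspaceW _ _ _ `[0, d]%classic).
  move=> x /=; rewrite !in_itv/= => /andP[ax xb].
  by rewrite (le_trans a0)//= (le_trans xb).
exact: (parameterized_integral_continuous d0 (integrable_continuous_itv 0 d cf)).
Qed.

Lemma Rintegral_point f t : \int[mu]_(u in `[t, t]) f u = 0.
Proof. by rewrite set_itv1 Rintegral_set1. Qed.

(** Heine-Cantor, by the near-covering form of compactness. Only [x] is confined to the segment,
    since [f] is continuous on the whole line. *)
Lemma uniform_continuity_itv f a b e : continuous f -> 0 < e ->
  exists2 d, 0 < d & forall x y, a <= x <= b -> `|x - y| < d -> `|f x - f y| < e.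
Proof.
move=> cf e0.
have /compact_near_coveringP/(_ R (0 : R)^'+
  (fun d x => forall y, `|x - y| < d -> `|f x - f y| < e)) := @segment_compact R a b.
case=> [x _|d' /= d'0 /(_ (d' / 2))].
  have e20 : 0 < e / 2 by rewrite divr_gt0.
  have /cvgrPdist_lt/(_ _ e20) := cf x.
  move=> /nbhs_ballP[r /= r0 xr].
  exists (ball x (r / 2), [set d | d < r / 2]) => //=.
    split; first by apply: nbhsx_ballx; rewrite divr_gt0.
    by apply: nbhs_right_lt; rewrite divr_gt0.
  case=> x' d /= [xx' dr] y x'y.
  have h1 : `|f x - f x'| < e / 2.
    by apply: xr; apply: lt_trans xx' _; rewrite ltr_pdivrMr// ltr_pMr// ltr1n.
  have h2 : `|f x - f y| < e / 2.
    apply: xr; rewrite /ball/= (splitr r).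
    have -> : x - y = (x - x') + (x' - y) by ring.
    by apply: (le_lt_trans (ler_normD _ _)); rewrite ltrD// (lt_trans x'y).
  have -> : f x' - f y = (f x - f y) - (f x - f x') by ring.
  by apply: (le_lt_trans (ler_normB _ _)); rewrite (splitr e) ltrD.
have d'20 : 0 < d' / 2 by rewrite divr_gt0.
move=> h; exists (d' / 2) => // x y axb xy.
have xab : `[a, b]%classic x by rewrite /= in_itv.
apply: (h _ d'20 x xab y xy).
by rewrite /= sub0r normrN gtr0_norm// ltr_pdivrMr// ltr_pMr// ltr1n.
Qed.

Definition riemann_sum f d (N : nat) : R :=
  \sum_(k < N) d / N%:R * f (d / N%:R * k%:R).

(** By the mean value theorem the integral over each cell is the mesh times a value of [f] in that
    cell, and uniform continuity compares it with the value at the left node. *)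
Lemma cvg_riemann_sum f d : continuous f -> 0 < d ->
  riemann_sum f d N @[N --> \oo] --> \int[mu]_(u in `[0, d]) f u.
Proof.
move=> cf d0; apply/cvgrPdist_le => e e0.
(* The cells have total length [d], so an error [e / d] per unit length adds up to [e]. *)
have ed0 : 0 < e / d by rewrite divr_gt0.
have [r r0 fr] := uniform_continuity_itv 0 d cf ed0.
exists (Num.truncn (d / r)).+1 => // N /= ltN.
have N0 : (0 : R) < N%:R by rewrite ltr0n; apply: leq_ltn_trans ltN.
set h := d / N%:R.
have h0 : 0 < h by rewrite divr_gt0.
have hr : h < r.
  rewrite ltr_pdivrMr// mulrC -ltr_pdivrMr//.
  by apply: (lt_le_trans (truncnS_gt _)); rewrite ler_nat.
have hN : h * N%:R = d by rewrite divfK ?gt_eqF.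
pose F t := \int[mu]_(u in `[0, t]) f u.
have -> : \int[mu]_(u in `[0, d]) f u = \sum_(k < N) (F (h * k.+1%:R) - F (h * k%:R)).
  rewrite -(big_mkord xpredT (fun k => F (h * k.+1%:R) - F (h * k%:R))).
  by rewrite telescope_sumr// mulr0 hN {2}/F Rintegral_point subr0.
rewrite /riemann_sum -/h -sumrB.
apply: (le_trans (ler_norm_sum _ _ _)).
have -> : e = \sum_(k < N) h * (e / d).
  rewrite sumr_const card_ord -mulr_natl mulrA [_ * h]mulrC hN.
  by rewrite mulrC divfK ?gt_eqF.
apply: ler_sum => -[k /= kN] _.
have hk : h * k%:R <= h * k.+1%:R by rewrite ler_pM2l// ler_nat.
have hk0 : 0 <= h * k%:R by rewrite mulr_ge0// ltW.
have hkd : h * k.+1%:R <= d by rewrite -hN ler_pM2l// ler_nat.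
have [x xk|c /[!in_itv]/= /andP[c1 c2] ->] := @MVT_segment R F f _ _ hk _
  (@continuous_integral0 f _ _ d cf hk0 hkd).
  apply: is_derive_integral0 => //; move: xk; rewrite in_itv/= => /andP[+ _].
  exact: le_lt_trans.
have hhk : h * k.+1%:R - h * k%:R = h by rewrite -mulrBr -natrB// subSnn mulr1.
rewrite hhk [f c * h]mulrC -mulrBr normrM (gtr0_norm h0) ler_pM2l//.
apply/ltW/fr; first by rewrite (le_trans hk0 c1) (le_trans c2).
rewrite ger0_norm ?subr_ge0//; apply: le_lt_trans hr.
by rewrite lerBlDr -[X in X + _]hhk subrK.
Qed.

(** Paths are assumed continuous on the half line only. Freezing them before time 0 gives a function
    continuous on the whole line with the same integrals over [0, t]; composition with the maximum
    is harmless because the latter is 1-Lipschitz. *)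
Lemma continuous_paths_extend (X : R -> R) :
  {within `[0, +oo[, continuous X} -> continuous (fun t => X (Num.max 0 t)).
Proof.
move=> /subspace_continuousP cX t.
have m0 : `[0, +oo[%classic (Num.max 0 t) by rewrite /= in_itv/= andbT le_max lexx.
apply: (cvg_comp (fun t => Num.max 0 t) X _ (cX _ m0)).
move=> A; rewrite /within/= => /nbhs_ballP[e /= e0 eA].
apply/nbhs_ballP; exists e => //= u tu.
apply: eA; last by rewrite in_itv/= andbT le_max lexx.
apply: le_lt_trans tu; rewrite /Order.max.
case: ifPn => t0; case: ifPn => u0 //.
- rewrite subr0 -leNgt in t0 u0 *; rewrite gtr0_norm//.
  by rewrite (le_trans _ (ler_norm _))// lerDl oppr_ge0.
- rewrite -leNgt in t0; rewrite sub0r normrN gtr0_norm//.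
  rewrite distrC (le_trans _ (ler_norm _))// lerDl oppr_ge0//.
- by rewrite subrr normr0.
Qed.

(** The integral I satisfies I' = y + k m t - k I + s B, a linear equation with merely continuous
    forcing: solving for I rather than for [X] never differentiates the noise. *)
Lemma OU_path_formula (k m y s : R) X B d :
  continuous X -> continuous B -> 0 < d ->
  (forall t, 0 <= t ->
    X t = y + \int[mu]_(u in `[0, t]) (k * (m - X u)) + s * B t) ->
  \int[mu]_(u in `[0, d]) X u =
    expR (- k * d) * (\int[mu]_(u in `[0, d]) (expR (k * u) * (y + k * m * u))
      + s * \int[mu]_(u in `[0, d]) (expR (k * u) * B u)) /\
  X d = y + k * m * d - k * \int[mu]_(u in `[0, d]) X u + s * B d.
Proof.
move=> cX cB d0 XE.
pose I t := \int[mu]_(u in `[0, t]) X u.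
have XI t : 0 <= t -> X t = y + k * m * t - k * I t + s * B t.
  move=> t0; rewrite XE//; congr (_ + _); rewrite -addrA; congr (_ + _).
  rewrite RintegralZl//; last first.
    apply: integrable_continuous_itv => u.
    by apply: cvgB; [exact: cvg_cst|exact: cX].
  rewrite RintegralB//; last 2 first.
  - by apply: integrable_continuous_itv => u; exact: cvg_cst.
  - exact: integrable_continuous_itv.
  rewrite Rintegral_cst//= lebesgue_measure_itv/= lte_fin.
  have -> : fine (if (0 < t)%R then (t%:E - 0%:E)%E else 0%E) = t.
    have [_|] := ltP 0 t; first by rewrite /= subr0.
    by move=> t0' /=; apply/eqP; rewrite eq_le t0 t0'.
  by rewrite -/(I t); ring.
have ce : continuous (fun u => expR (k * u)).
  move=> u; apply: (cvg_comp _ expR); last exact: continuous_expR.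
  by apply: cvgM; [exact: cvg_cst|exact: cvg_id].
have c1 : continuous (fun u => expR (k * u) * (y + k * m * u)).
  move=> u; apply: cvgM; first exact: ce.
  by apply: cvgD; [exact: cvg_cst|apply: cvgM; [exact: cvg_cst|exact: cvg_id]].
have c2 : continuous (fun u => expR (k * u) * B u).
  by move=> u; apply: cvgM; [exact: ce|exact: cB].
have c2s : continuous (fun u => s * (expR (k * u) * B u)).
  by move=> u; apply: cvgM; [exact: cvg_cst|exact: c2].
pose g u := expR (k * u) * (y + k * m * u) + s * (expR (k * u) * B u).
have cg : continuous g by move=> u; apply: cvgD; [exact: c1|exact: c2s].
(* Variation of constants: [g] is the integrating factor times the forcing, so [H] has zero
   derivative and keeps its value 0 at time 0. *)
pose H t := expR (k * t) * I t - \int[mu]_(u in `[0, t]) g u.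
have dE t : is_derive t 1 (fun u => expR (k * u)) (k * expR (k * t)).
  have h : is_derive t 1 (fun u => k * u) k.
    by apply: is_derive_eq; rewrite /GRing.scale/=; ring.
  have h' := @is_derive1_comp R expR _ t _ _ (is_derive_expR _) h.
  by apply: (is_derive_eq h'); rewrite mulrC.
have dH t : 0 < t -> is_derive t 1 H 0.
  move=> t0.
  have h1 := is_deriveM (dE t) (is_derive_integral0 cX t0).
  have h2 := is_deriveB h1 (is_derive_integral0 cg t0).
  apply: (is_derive_eq h2); rewrite /GRing.scale/= -/(I t) /g.
  by rewrite (XI t (ltW t0)); ring.
have : H d - H 0 = 0 * (d - 0).
  have dH' (x : R) : x \in `]0, d[ -> is_derive x 1 H ((fun=> 0) x).
    by move=> /[!in_itv]/= /andP[x0 _]; exact: dH.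
  have cH : {within `[0, d], continuous H}.
    have wI := @continuous_integral0 X 0 d d cX (lexx _) (lexx _).
    have wg := @continuous_integral0 g 0 d d cg (lexx _) (lexx _).
    have we : {within `[0, d], continuous (fun u => expR (k * u))}.
      exact: continuous_subspaceT.
    by move=> x; apply: cvgB; [apply: cvgM; [exact: we|exact: wI]|exact: wg].
  by have [x _ ->] := MVT_segment (ltW d0) dH' cH.
rewrite mul0r /H /I !Rintegral_point mulr0 subr0 subr0 => /eqP.
rewrite subr_eq0 => /eqP HE; split; last exact: XI (ltW d0).
have -> : \int[mu]_(u in `[0, d]) X u =
    expR (- k * d) * (expR (k * d) * \int[mu]_(u in `[0, d]) X u).
  by rewrite mulrA -expRD mulNr addNr expR0 mul1r.
rewrite HE /g; congr (_ * _).
rewrite RintegralD//; try exact: integrable_continuous_itv.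
congr (_ + _); rewrite RintegralZl//; exact: integrable_continuous_itv.
Qed.

End integral_continuous.

(** * Linear combinations and independent increments *)

Definition qform (R : realType) n (A : 'M[R]_n) (v : 'cV[R]_n) : R :=
  (v^T *m A *m v) 0 0.

Lemma qformE (R : realType) n (A : 'M[R]_n) (v : 'cV[R]_n) :
  qform A v = \sum_i v i 0 * \sum_j v j 0 * A i j.
Proof.
rewrite /qform mxE.
under eq_bigr => j _ do rewrite mxE big_distrl/=.
rewrite exchange_big/=; apply: eq_bigr => i _.
rewrite big_distrr/=; apply: eq_bigr => j _.
by rewrite mxE; ring.
Qed.

Lemma lincombE (R : realType) n (a x : 'cV[R]_n) :
  (a^T *m x) 0 0 = \sum_i a i 0 * x i 0.
Proof. by rewrite mxE; apply: eq_bigr => i _; rewrite mxE. Qed.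

Lemma lincomb_delta (R : realType) T n (X : T -> 'cV[R]_n) i :
  (fun w => ((delta_mx i 0 : 'cV[R]_n)^T *m X w) 0 0) = (fun w => X w i 0).
Proof.
apply/funext => w; rewrite lincombE (bigD1 i)//= big1 => [|j ji].
  by rewrite mxE !eqxx mul1r addr0.
by rewrite mxE (negbTE ji) mul0r.
Qed.

Section covariance_lincomb.
Context d (T : measurableType d) (R : realType) (P : probability T R).

Let Pfin : P setT \is a fin_num := fin_num_measure P _ measurableT.

Lemma Lfun2_lincomb (I : Type) (s : seq I) (a : I -> R) (X : I -> T -> R) :
  (forall i, X i \in Lfun P 2%:E) ->
  (fun w => \sum_(i <- s) a i * X i w) \in Lfun P 2%:E.
Proof.
move=> X2; elim: s => [|i s IHs].
  rewrite (_ : (fun w => _) = cst 0); first exact: Lfun_cst.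
  by apply/funext => w; rewrite big_nil.
rewrite (_ : (fun w => _) =
  (a i \o* X i) \+ (fun w => \sum_(j <- s) a j * X j w)); last first.
  by apply/funext => w; rewrite big_cons/= mulrC.
have h : (a i \o* X i) \in Lfun P 2%:E by apply: Lfun_scale; rewrite ?ler1n.
by rewrite rpredD ?lee1n//=.
Qed.

Lemma expectation_lincomb (I : Type) (s : seq I) (a : I -> R) (X : I -> T -> R) :
  (forall i, X i \in Lfun P 2%:E) ->
  fine 'E_P[fun w => (\sum_(i <- s) a i * X i w)%R]%E =
  \sum_(i <- s) a i * fine ('E_P[X i])%E.
Proof.
move=> X2; elim: s => [|i s IHs].
  rewrite big_nil (_ : (fun w => _) = cst 0%R) ?expectation_cst//.
  by apply/funext => w; rewrite big_nil.
rewrite big_cons -IHs (_ : (fun w => \sum_(j <- i :: s) _) =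
  (a i \o* X i) \+ (fun w => \sum_(j <- s) a j * X j w)); last first.
  by apply/funext => w; rewrite big_cons/= mulrC.
have X1 := Lfun_subset12 Pfin (X2 i).
have S1 := Lfun_subset12 Pfin (Lfun2_lincomb s a X2).
have aX1 : (a i \o* X i) \in Lfun P 1 by apply: Lfun_scale.
rewrite expectationD// fineD ?expectation_fin_num//.
by rewrite expectationZl// fineM// expectation_fin_num.
Qed.

Lemma covariance_lincomb_l (I : Type) (s : seq I) (a : I -> R)
    (X : I -> T -> R) (Y : T -> R) :
  (forall i, X i \in Lfun P 2%:E) -> Y \in Lfun P 2%:E ->
  fine (covariance P (fun w => \sum_(i <- s) a i * X i w) Y) =
  \sum_(i <- s) a i * fine (covariance P (X i) Y).
Proof.
move=> X2 Y2; elim: s => [|i s IHs].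
  rewrite big_nil (_ : (fun w => _) = cst 0%R) ?covariance_cst_l//.
  by apply/funext => w; rewrite big_nil.
rewrite big_cons -IHs (_ : (fun w => \sum_(j <- i :: s) _) =
  (a i \o* X i) \+ (fun w => \sum_(j <- s) a j * X j w)); last first.
  by apply/funext => w; rewrite big_cons/= mulrC.
have S2 := Lfun2_lincomb s a X2.
have h : (a i \o* X i) \in Lfun P 2%:E by apply: Lfun_scale; rewrite ?ler1n.
have Y1 := Lfun_subset12 Pfin Y2.
have X1 := Lfun_subset12 Pfin (X2 i).
have S1 := Lfun_subset12 Pfin S2.
have h1 := Lfun_subset12 Pfin h.
have XY1 := Lfun2_mul_Lfun1 (X2 i) Y2.
have SY1 := Lfun2_mul_Lfun1 S2 Y2.
have hY1 := Lfun2_mul_Lfun1 h Y2.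
rewrite covarianceDl// fineD ?covariance_fin_num//.
by rewrite covarianceZl// fineM// covariance_fin_num.
Qed.

Lemma covariance_lincomb n m (a : 'cV[R]_n) (b : 'cV[R]_m)
    (X : T -> 'cV[R]_n) (Y : T -> 'cV[R]_m) :
  (forall i, (fun w => X w i 0) \in Lfun P 2%:E) ->
  (forall i, (fun w => Y w i 0) \in Lfun P 2%:E) ->
  fine (covariance P (fun w => (a^T *m X w) 0 0) (fun w => (b^T *m Y w) 0 0)) =
  \sum_i a i 0 * \sum_j b j 0 *
    fine (covariance P (fun w => X w i 0) (fun w => Y w j 0)).
Proof.
move=> X2 Y2.
rewrite (_ : (fun w => (a^T *m X w) 0 0) = (fun w => \sum_i a i 0 * X w i 0)); last first.
  by apply/funext => w; rewrite lincombE.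
rewrite (_ : (fun w => (b^T *m Y w) 0 0) = (fun w => \sum_i b i 0 * Y w i 0)); last first.
  by apply/funext => w; rewrite lincombE.
rewrite (covariance_lincomb_l _ _ (X := fun i w => X w i 0))//; last first.
  exact: (Lfun2_lincomb _ _ (X := fun i w => Y w i 0)).
apply: eq_bigr => i _; congr (_ * _).
rewrite covarianceC (covariance_lincomb_l _ _ (X := fun i w => Y w i 0))//.
by apply: eq_bigr => j _; rewrite covarianceC.
Qed.

Lemma variance_lincomb n (a : 'cV[R]_n) (X : T -> 'cV[R]_n) :
  (forall i, (fun w => X w i 0) \in Lfun P 2%:E) ->
  fine 'V_P[fun w => (a^T *m X w) 0%R 0%R]%E = qform (cov_mx P X) a.
Proof.
move=> X2; rewrite /variance covariance_lincomb// qformE.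
apply: eq_bigr => i _; congr (_ * _); apply: eq_bigr => j _.
by rewrite mxE.
Qed.

Lemma normal_rv_Lfun2 (X : T -> R) : normal_rv P X -> X \in Lfun P 2%:E.
Proof. by move=> /normal_rv_law[m [s [_ /normal_law_Lfun2]]]. Qed.

Lemma normal_lincomb_Lfun2 n (X : T -> 'cV[R]_n) :
  (forall a : 'cV[R]_n, normal_rv P (fun w => (a^T *m X w) 0 0)) ->
  forall i, (fun w => X w i 0) \in Lfun P 2%:E.
Proof.
move=> nX i; have := normal_rv_Lfun2 (nX (delta_mx i 0)).
by rewrite lincomb_delta.
Qed.

(** [normal_rv] only asserts that some parameters exist; the mean and the variance of the
    combination identify them. *)
Lemma multinormal_lincomb n (X : T -> 'cV[R]_n) m S (a : 'cV[R]_n) :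
  multinormal P X m S ->
  has_normal_law P (fun w => (a^T *m X w) 0 0) ((a^T *m m) 0 0)
    (Num.sqrt (qform S a)).
Proof.
move=> [nX <- <-]; have X2 := normal_lincomb_Lfun2 nX.
have [m' [s' [s'0 Xlaw]]] := normal_rv_law (nX a).
rewrite -variance_lincomb// (normal_law_variance Xlaw)/= sqrtr_sqr ger0_norm//.
suff -> : (a^T *m mean_vec P X) 0 0 = m' by [].
rewrite lincombE.
have -> : m' = fine 'E_P[fun w => ((a^T *m X w) 0 0)%R]%E.
  by rewrite (normal_law_expectation Xlaw).
rewrite (_ : (fun w => (a^T *m X w) 0 0) = (fun w => \sum_i a i 0 * X w i 0)); last first.
  by apply/funext => w; rewrite lincombE.
rewrite (expectation_lincomb _ _ (X := fun i w => X w i 0))//.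
by apply: eq_bigr => i _; rewrite mxE.
Qed.

End covariance_lincomb.

Lemma sigma_rv_measurable d (T : measurableType d) (R : realType) n
    (X : T -> 'cV[R]_n) : (forall i, measurable_fun setT (fun w => X w i 0)) ->
  sigma_rv X `<=` measurable.
Proof.
move=> mX; apply: smallest_sub; first exact: sigma_algebra_measurable.
elim/big_rec: _ => [|i U _ IH]; first exact: sub0set.
rewrite subUset; split => // A [B mB <-].
by have := mX i measurableT B mB.
Qed.

Lemma lincomb_sigma_rv d (T : measurableType d) (R : realType) n
    (X : T -> 'cV[R]_n) (a : 'cV[R]_n) (B : set R) : measurable B ->
  sigma_rv X ((fun w => (a^T *m X w) 0 0) @^-1` B).
Proof.
move=> mB.
pose G := \big[setU/set0]_(i < n)
  preimage_set_system setT (fun w : T => X w i 0) measurable.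
have mXi i : @measurable_fun _ _ (g_sigma_algebraType G) R setT (fun w => X w i 0).
  move=> _ C mC; apply: sub_sigma_algebra.
  rewrite /G (bigD1 i)//=; left; exists C => //.
have : @measurable_fun _ _ (g_sigma_algebraType G) R setT (fun w => (a^T *m X w) 0 0).
  rewrite (_ : (fun w => _) = (fun w => \sum_i a i 0 * X w i 0)); last first.
    by apply/funext => w; rewrite lincombE.
  apply: measurable_sum => i; apply: measurable_funM => //.
by move=> /(_ measurableT B mB); rewrite setTI.
Qed.

Section independent_increments.
Context d (T : measurableType d) (R : realType) (P : probability T R) (n : nat).
Variables (N : nat) (X : nat -> T -> 'cV[R]_n) (S : nat -> 'M[R]_n).
Hypothesis X_law : forall k, multinormal P (X k) 0 (S k).
Hypothesis X_ind : independent_rvs P N X.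

Let mX k i : measurable_fun setT (fun w => X k w i 0).
Proof.
by have [nX _ _] := X_law k; have [+ _] := nX (delta_mx i 0); rewrite lincomb_delta.
Qed.

Let P_bigcap (j : nat) (A : nat -> set T) : (j <= N)%N ->
  (forall k, (j <= k < N)%N -> sigma_rv (X k) (A k)) ->
  P (\bigcap_(k in [set k | (j <= k < N)%N]) A k) =
  (\prod_(j <= k < N) P (A k))%E.
Proof.
move=> jN sA; pose A' k := if (j <= k)%N then A k else setT.
have := X_ind (A := A').
rewrite (_ : \bigcap_(k in `I_N) A' k =
  \bigcap_(k in [set k | (j <= k < N)%N]) A k); last first.
  apply/seteqP; split => w /= h k /=.
    by move=> /andP[jk kN]; have := h k kN; rewrite /A' jk.
  by move=> kN; rewrite /A'; case: ifP => // jk; apply: h => /=; rewrite jk.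
move=> ->; last first.
  move=> k kN; rewrite /A'; case: ifP => jk; first by apply: sA; rewrite jk.
  by have := @lincomb_sigma_rv _ T R n (X k) 0 setT measurableT; rewrite preimage_setT.
rewrite -(big_mkord xpredT (fun k => P (A' k))).
rewrite (big_cat_nat (n := j))//= big_nat big1 ?mul1e; last first.
  by move=> k /andP[_ kj]; rewrite /A' leqNgt kj probability_setT.
by rewrite big_nat [RHS]big_nat; apply: eq_bigr => k /andP[jk _]; rewrite /A' jk.
Qed.

(** Keeping the events of the later vectors in the statement lets the induction run: at each step
    one of these events is spent on the next summand. For [j = N] only the law of the whole sum
    remains. *)
Let law_prefix (c : nat -> 'cV[R]_n) (j : nat) : (j <= N)%N ->
  forall (B : set R) (A : nat -> set T), measurable B ->
  (forall k, (j <= k < N)%N -> sigma_rv (X k) (A k)) ->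
  P ((fun w => \sum_(k < j) ((c k)^T *m X k w) 0 0) @^-1` B `&`
     \bigcap_(k in [set k | (j <= k < N)%N]) A k) =
  (normal_prob (0 : R) 1
     [set z | B (0 + Num.sqrt (\sum_(k < j) qform (S k) (c k)) * z)%R] *
   \prod_(j <= k < N) P (A k))%E.
Proof.
elim: j => [_ B A mB sA|j IHj jN B A mB sA].
  rewrite -P_bigcap//.
  (* The empty sum is 0 and its scale is 0, so both sides only ask whether 0 lies in [B]. *)
  have [B0|B0] := pselect (B 0).
    rewrite (_ : _ @^-1` B = setT); last first.
      by apply/seteqP; split => // w _ /=; rewrite big_ord0.
    rewrite setTI (_ : [set z | B (0 + _ * z)%R] = setT) ?probability_setT ?mul1e//.
    by apply/seteqP; split => // z _ /=; rewrite big_ord0 sqrtr0 mul0r addr0.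
  rewrite (_ : _ @^-1` B = set0); last first.
    by apply/seteqP; split => // w /=; rewrite big_ord0.
  rewrite set0I measure0 (_ : [set z | B (0 + _ * z)%R] = set0) ?measure0 ?mul0e//.
  by apply/seteqP; split => // z /=; rewrite big_ord0 sqrtr0 mul0r addr0.
pose A' := \bigcap_(k in [set k | (j < k < N)%N]) A k.
have sA' k : (j < k < N)%N -> measurable (A k).
  by move=> jk; apply: (sigma_rv_measurable (mX k)); exact: sA.
have mA' : measurable A' by apply: bigcap_measurableType => k; exact: sA'.
have mlin k : measurable_fun setT (fun w => ((c k)^T *m X k w) 0 0).
  by have [nX _ _] := X_law k; have [] := nX (c k).
have mSj : measurable_fun setT (fun w => \sum_(k < j) ((c k)^T *m X k w) 0 0).
  by apply: measurable_sum => k; exact: mlin.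
have qS0 k : 0 <= qform (S k) (c k).
  have [nX _ <-] := X_law k; rewrite -variance_lincomb.
    by rewrite fine_ge0// variance_ge0.
  exact: normal_lincomb_Lfun2.
have sq0 : 0 <= \sum_(k < j) qform (S k) (c k) by apply: sumr_ge0.
rewrite (_ : (fun w => _) = (fun w => \sum_(k < j) ((c k)^T *m X k w) 0 0 +
    ((c j)^T *m X j w) 0 0)); last by apply/funext => w; rewrite big_ord_recr.
have -> : \sum_(k < j.+1) qform (S k) (c k) =
    Num.sqrt (\sum_(k < j) qform (S k) (c k)) ^+ 2 +
    Num.sqrt (qform (S j) (c j)) ^+ 2.
  by rewrite big_ord_recr/= !sqr_sqrtr.
rewrite -P_bigcap//.
apply: (normal_law_add_independent mSj (mlin j) mA') => //.
move=> B1 B2 mB1 mB2.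
(* Independence of the partial sum and the term of index [j] is the induction hypothesis with the
   event of index [j] taken to be a preimage under that term. *)
pose A2 k := if k == j then (fun w => ((c j)^T *m X j w) 0 0) @^-1` B2 else A k.
have sA2 k : (j <= k < N)%N -> sigma_rv (X k) (A2 k).
  rewrite /A2; case: eqVneq => [->|kj] /andP[jk kN].
    by move=> *; exact: lincomb_sigma_rv.
  by apply: sA; rewrite kN andbT ltn_neqAle eq_sym kj.
have := IHj (ltnW jN) B1 A2 mB1 sA2.
rewrite (_ : \bigcap_(k in [set k | (j <= k < N)%N]) A2 k =
  (fun w => ((c j)^T *m X j w) 0 0) @^-1` B2 `&` A'); last first.
  apply/seteqP; split => w /=.
    move=> h; split; first by have := h j; rewrite /= /A2 leqnn jN eqxx; apply.
    move=> k /= /andP[jk kN]; have := h k; rewrite /= /A2 (ltnW jk) kN.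
    by rewrite gtn_eqF//; apply.
  move=> [h1 h2] k /= /andP[jk kN]; rewrite /A2; case: eqVneq => // kj.
  by apply: h2 => /=; rewrite kN andbT ltn_neqAle eq_sym kj.
rewrite setIA => ->.
have [_ XjE] := multinormal_lincomb (c j) (X_law j).
rewrite big_ltn// {1}/A2 eqxx XjE// mulmx0 mxE.
rewrite muleA; congr (_ * _)%E.
rewrite P_bigcap//; rewrite big_nat [RHS]big_nat.
by apply: eq_bigr => k /andP[jk _]; rewrite /A2 gtn_eqF.
Qed.

Lemma independent_sum_law (c : nat -> 'cV[R]_n) :
  has_normal_law P (fun w => \sum_(k < N) ((c k)^T *m X k w) 0 0) 0
    (Num.sqrt (\sum_(k < N) qform (S k) (c k))).
Proof.
split.
  apply: measurable_sum => k.
  by have [nX _ _] := X_law k; have [] := nX (c k).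
move=> B mB.
have := @law_prefix c N (leqnn N) B (fun=> setT) mB.
rewrite (_ : \bigcap_(k in _) _ = setT); last first.
  by apply/seteqP; split.
rewrite setIT big_geq// mule1; apply.
by move=> k /andP[jk kN]; move: (leq_ltn_trans jk kN); rewrite ltnn.
Qed.

End independent_increments.

(** * Discretized functionals and their variances *)

Section quadratic_forms.
Context (R : realType) (n : nat).
Implicit Types (A : 'M[R]_n) (u v : 'cV[R]_n).

Lemma qformD A (c d : R) u v : qform A (c *: u + d *: v) =
  c ^+ 2 * qform A u + c * d * ((u^T *m A *m v) 0 0 + (v^T *m A *m u) 0 0)
  + d ^+ 2 * qform A v.
Proof.
rewrite /qform [(_ + _)^T]raddfD/= ![(_ *: _)^T]linearZ/=.
rewrite !mulmxDl !mulmxDr -!scalemxAl -!scalemxAr.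
by rewrite !mxE; ring.
Qed.

(** Cauchy-Schwarz for the form q of [A]: v_i is the pairing of v with y = A^-1 e_i, so v_i^2 <=
    q(y) q(v). It plays the part of a smallest eigenvalue. Adding 1 to q(y) makes the constant
    positive. *)
Lemma psd_coordinate_bound A (i : 'I_n) : A^T = A ->
  (forall v, 0 <= qform A v) -> A \in unitmx ->
  exists2 g : R, 0 < g & forall v, (v i 0) ^+ 2 <= g * qform A v.
Proof.
move=> AT A0 uA; pose y : 'cV[R]_n := invmx A *m delta_mx i 0.
exists (qform A y + 1); first by rewrite ltr_wpDl.
move=> v.
have vy : (v^T *m A *m y) 0 0 = v i 0.
  by rewrite -mulmxA (mulKVmx uA) -colE !mxE.
have yv : (y^T *m A *m v) 0 0 = v i 0.
  have -> : y^T *m A *m v = (v^T *m A *m y)^T.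
    by rewrite !trmx_mul trmxK AT mulmxA.
  by rewrite mxE.
set g := qform A y + 1.
(* Since q(y) = g - 1, this nonnegative value is g (g q(v) - v_i^2) - v_i^2. *)
have := A0 (g *: v + (- v i 0) *: y); rewrite qformD vy yv.
have g1 : 0 < g by rewrite ltr_wpDl.
have -> : qform A y = g - 1 by rewrite /g; ring.
move=> h; rewrite -subr_ge0 -(pmulr_rge0 _ g1).
have := sqr_ge0 (v i 0); nra.
Qed.

End quadratic_forms.

(** Summation by parts: a weighted sum of values of a path becomes a weighted sum of its increments,
    which for Brownian motion are independent. Each increment collects the weights of all later
    nodes. *)
Lemma abel_sum (R : realType) (N : nat) (f w : nat -> R) :
  \sum_(k < N) (\sum_(l < N | (k < l)%N) f l) * (w k.+1 - w k) =
  \sum_(l < N) f l * (w l - w 0%N).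
Proof.
under eq_bigr => k _ do rewrite big_distrl big_mkcond/=.
rewrite exchange_big/=; apply: eq_bigr => l _.
rewrite -big_mkcond -big_distrr/=; congr (_ * _).
rewrite -(big_ord_widen _ (fun k => w k.+1 - w k)) ?(ltnW (ltn_ord l))//.
by rewrite -(big_mkord xpredT (fun k => w k.+1 - w k)) telescope_sumr.
Qed.

Lemma sqr_le_scaled (R : realType) (c x y : R) : 0 <= x -> x <= y ->
  (c * x) ^+ 2 <= (c * y) ^+ 2.
Proof.
move=> x0 xy; rewrite !exprMn ler_wpM2l ?sqr_ge0//.
by rewrite lerXn2r// nnegrE// (le_trans x0).
Qed.

Section discretization.
Context (R : realType) (n : nat) (rho : 'M[R]_n) (kk : 'I_n -> R) (d : R).
Implicit Types (a b : 'cV[R]_n).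

(** A Riemann sum of exp(kk_i u) over the nodes after [k]: the weight that summation by parts puts
    on the increment of index [k]. *)
Definition disc_weight (N : nat) (i : 'I_n) (k : nat) : R :=
  \sum_(l < N | (k < l)%N) d / N%:R * expR (kk i * (d / N%:R * l%:R)).

Definition disc_coef (N : nat) a b (k : nat) : 'cV[R]_n :=
  \col_i (a i 0 + b i 0 * disc_weight N i k).

(** The variance of the discretized functional: independent increments with covariance (d / N) rho,
    weighted by [disc_coef]. *)
Definition disc_var (N : nat) a b : R :=
  \sum_(k < N) d / N%:R * qform rho (disc_coef N a b k).

Hypothesis d0 : 0 < d.
Hypothesis rho0 : forall v, 0 <= qform rho v.

Lemma disc_var_ge0 N a b : 0 <= disc_var N a b.
Proof.
apply: sumr_ge0 => k _; apply: mulr_ge0 => //.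
by rewrite divr_ge0// ltW.
Qed.

Lemma expR_itv_bound (c u : R) : 0 <= u <= d ->
  expR (- (`|c| * d)) <= expR (c * u) <= expR (`|c| * d).
Proof.
move=> /andP[u0 ud]; rewrite !ler_expR -ler_norml normrM (ger0_norm u0).
exact: ler_wpM2l.
Qed.

Lemma grid_itv (N l : nat) : (l < N)%N -> 0 <= d / N%:R * l%:R <= d.
Proof.
move=> lN; have N0 : (0 : R) < N%:R by rewrite ltr0n (leq_ltn_trans _ lN).
rewrite mulr_ge0 ?divr_ge0 ?(ltW d0)//=.
by rewrite mulrAC ler_pdivrMr// ler_pM2l// ler_nat ltnW.
Qed.

Lemma disc_weight_bound N i k : (0 < N)%N ->
  `|disc_weight N i k| <= d * expR (`|kk i| * d).
Proof.
move=> N0; have N0' : (0 : R) < N%:R by rewrite ltr0n.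
apply: (le_trans (ler_norm_sum _ _ _)).
rewrite big_mkcond/=.
have -> : d * expR (`|kk i| * d) = \sum_(l < N) d / N%:R * expR (`|kk i| * d).
  by rewrite sumr_const card_ord -mulr_natl; field; rewrite gt_eqF.
apply: ler_sum => l _; case: ifP => _; last first.
  by rewrite mulr_ge0 ?expR_ge0 ?divr_ge0 ?(ltW d0).
rewrite ger0_norm ?mulr_ge0 ?expR_ge0 ?divr_ge0 ?(ltW d0)//.
rewrite ler_wpM2l ?divr_ge0 ?(ltW d0)//.
by have /andP[] := expR_itv_bound (kk i) (grid_itv (ltn_ord l)).
Qed.

(** The coefficients are bounded uniformly in the node and in [N], and the step lengths add up to
    [d]. *)
Lemma disc_var_bounded a b : exists M : R, forall N, (0 < N)%N -> disc_var N a b <= M.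
Proof.
pose m i := `|a i 0| + `|b i 0| * (d * expR (`|kk i| * d)).
have m0 i : 0 <= m i by rewrite addr_ge0// mulr_ge0// mulr_ge0 ?expR_ge0// ltW.
pose Q := \sum_i m i * \sum_j m j * `|rho i j|.
exists (d * Q) => N N0; have N0' : (0 : R) < N%:R by rewrite ltr0n.
have -> : d * Q = \sum_(k < N) d / N%:R * Q.
  by rewrite sumr_const card_ord -mulr_natl; field; rewrite gt_eqF.
apply: ler_sum => k _; rewrite ler_wpM2l ?divr_ge0 ?(ltW d0)//.
have cm i : `|disc_coef N a b k i 0| <= m i.
  rewrite mxE (le_trans (ler_normD _ _))// lerD2l normrM.
  by rewrite ler_wpM2l// disc_weight_bound.
rewrite qformE (le_trans (ler_norm _))// (le_trans (ler_norm_sum _ _ _))//.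
apply: ler_sum => i _; rewrite normrM ler_pM//.
rewrite (le_trans (ler_norm_sum _ _ _))//.
by apply: ler_sum => j _; rewrite normrM ler_wpM2r.
Qed.

(* Pairing the nodes [k] and [k + M]: the weights of the integral decrease by
   a fixed amount over half of the interval, so that [a + b * weight] cannot be
   small at both nodes. *)
Lemma disc_weight_drop (M : nat) i k : (k < M)%N ->
  d / 2 * expR (- (`|kk i| * d)) <=
  disc_weight M.*2 i k - disc_weight M.*2 i (k + M).
Proof.
move=> kM; have M0 : (0 < M)%N by rewrite (leq_ltn_trans _ kM).
have M0' : (0 : R) < M%:R by rewrite ltr0n.
set N := M.*2; pose f (l : nat) := d / N%:R * expR (kk i * (d / N%:R * l%:R)).
have NE : N%:R = 2 * M%:R :> R by rewrite /N -mul2n natrM.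
have -> : disc_weight N i k - disc_weight N i (k + M) =
    \sum_(l < N | (k < l <= k + M)%N) f l.
  rewrite /disc_weight (bigID (fun l : 'I_N => (l <= k + M)%N))/=.
  rewrite [X in _ + X - _](eq_bigl (fun l : 'I_N => (k + M < l)%N)).
    by rewrite addrK.
  move=> l; rewrite -ltnNge; case: (ltnP (k + M) l) => h; rewrite ?andbF//.
  by rewrite andbT (leq_ltn_trans (leq_addr _ _) h).
(* As k < M, the [M] nodes after [k] lie below N = 2 M, and M steps of length d / N make d / 2. *)
have -> : d / 2 * expR (- (`|kk i| * d)) =
    \sum_(l < N | (k < l <= k + M)%N) d / N%:R * expR (- (`|kk i| * d)).
  rewrite sumr_const (_ : #|_| = M).
    by rewrite NE -mulr_natl; field; rewrite gt_eqF.
  rewrite -sum1_card (eq_bigl (fun l : 'I_N => (k < l <= k + M)%N))//.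
  rewrite -(big_mkord (fun l => (k < l <= k + M)%N) (fun=> 1%N)).
  rewrite (big_cat_nat (n := k.+1))//=; last by rewrite /N -addnn; lia.
  rewrite (big_cat_nat (n := (k + M).+1) (m := k.+1))//=; last 2 first.
  - by rewrite ltnS leq_addr.
  - by rewrite /N -addnn; lia.
  rewrite big_nat_cond big_pred0; last by move=> l; lia.
  rewrite [X in (_ + (_ + X))%N]big_nat_cond.
  rewrite [X in (_ + (_ + X))%N]big_pred0; last by move=> l; lia.
  rewrite big_nat_cond (eq_bigl (fun l => (k.+1 <= l < (k + M).+1)%N)).
    by rewrite -big_nat sum_nat_const_nat; lia.
  by move=> l; lia.
apply: ler_sum => l _; rewrite ler_wpM2l ?divr_ge0 ?(ltW d0)//.
by have /andP[] := expR_itv_bound (kk i) (grid_itv (ltn_ord l)).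
Qed.

Hypothesis rho_sym : rho^T = rho.
Hypothesis rho_unit : rho \in unitmx.

(** Some coordinate i has a nonzero coefficient, and by [psd_coordinate_bound] it suffices to bound
    below the sum of its squares over the nodes. If b_i = 0 the coordinate is constant; otherwise
    paired nodes use p^2 + q^2 >= (p - q)^2 / 2. *)
Lemma disc_var_lower_bound a b : (a, b) != (0, 0) ->
  exists2 e : R, 0 < e & forall M, (0 < M)%N -> e <= disc_var M.*2 a b.
Proof.
move=> ab.
have [i abi] : exists i, (a i 0 != 0) || (b i 0 != 0).
  apply/existsP; apply: contraNT ab => /existsPn ab0.
  rewrite xpair_eqE; apply/andP; split; apply/eqP/colP => i;
  by have := ab0 i; rewrite negb_or !negbK !mxE => /andP[/eqP ? /eqP ?].
have [g g0 gE] := psd_coordinate_bound i rho_sym rho0 rho_unit.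
have lb M : (0 < M)%N -> d / M.*2%:R / g * \sum_(k < M.*2) (disc_coef M.*2 a b k i 0) ^+ 2
    <= disc_var M.*2 a b.
  move=> M0; rewrite big_distrr/=; apply: ler_sum => k _.
  rewrite -mulrA ler_wpM2l ?divr_ge0 ?(ltW d0)//.
  by rewrite mulrC ler_pdivrMr// mulrC gE.
have [b0|b0] := eqVneq (b i 0) 0.
  rewrite b0 eqxx orbF in abi.
  exists (d / g * (a i 0) ^+ 2).
    by rewrite mulr_gt0 ?divr_gt0// exprn_even_gt0.
  move=> M M0; apply: le_trans (lb M M0).
  under eq_bigr do rewrite mxE b0 mul0r addr0.
  have M0' : (0 : R) < M.*2%:R by rewrite ltr0n double_gt0.
  rewrite sumr_const card_ord -[X in _ <= _ * X]mulr_natl.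
  rewrite le_eqVlt; apply/orP; left; apply/eqP.
  by field; rewrite !gt_eqF.
pose e0 := d / 2 * expR (- (`|kk i| * d)).
have e00 : 0 < e0 by rewrite mulr_gt0 ?expR_gt0 ?divr_gt0.
(* Each of the [M] pairs contributes at least (b_i e0)^2 / 2, with prefactor d / (2 M g), whence d /
   (4 g). *)
exists (d / 4 / g * (b i 0 * e0) ^+ 2).
  by rewrite mulr_gt0 ?divr_gt0// exprn_even_gt0//= mulf_neq0// gt_eqF.
move=> M M0; apply: le_trans (lb M M0).
have M0' : (0 : R) < M%:R by rewrite ltr0n.
have split_sum (F : nat -> R) : \sum_(k < M.*2) F k = \sum_(k < M) (F k + F (k + M)%N).
  rewrite -addnn big_split_ord/= -big_split/=; apply: eq_bigr => k _.
  by rewrite addnC.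
rewrite (split_sum (fun k => disc_coef M.*2 a b k i 0 ^+ 2)).
have : \sum_(k < M) (b i 0 * e0) ^+ 2 / 2 <=
    \sum_(k < M) (disc_coef M.*2 a b k i 0 ^+ 2 + disc_coef M.*2 a b (k + M) i 0 ^+ 2).
  apply: ler_sum => k _; rewrite !mxE.
  have := disc_weight_drop i (ltn_ord k); rewrite -/e0.
  set x := disc_weight _ _ k; set y := disc_weight _ _ (k + M) => xy.
  have h : (b i 0 * e0) ^+ 2 <= (b i 0 * (x - y)) ^+ 2.
    exact: sqr_le_scaled (ltW e00) xy.
  apply: (le_trans (ler_wpM2r _ h)) => //.
  have := sqr_ge0 (a i 0 + b i 0 * x + (a i 0 + b i 0 * y)); nra.
rewrite sumr_const card_ord => h.
apply: le_trans (ler_wpM2l _ h); last by rewrite !divr_ge0// ltW.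
rewrite -mulr_natl -mul2n natrM le_eqVlt; apply/orP; left; apply/eqP.
by field; rewrite !gt_eqF.
Qed.

(** Compactness of the segment between the two bounds. The number of steps [M.+1.*2] is even, for
    the pairing of nodes, and never 0. No process is mentioned, so a single cluster point can serve
    every model. *)
Lemma disc_sd_cluster a b : exists s : R,
  [/\ 0 <= s, (a, b) != (0, 0) -> 0 < s &
   cluster ((fun M => Num.sqrt (disc_var M.+1.*2 a b)) @ \oo) s].
Proof.
have [M ubM] := disc_var_bounded a b.
(* The lower bound defaults to 0 when all coefficients vanish, so that one segment covers both
   cases. *)
pose e : R := if pselect ((a, b) != (0, 0)) is left h
  then s2val (cid2 (disc_var_lower_bound h)) else 0.
have eP : (0 <= e) /\ ((a, b) != (0, 0) -> 0 < e) /\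
    forall N, (0 < N)%N -> e <= disc_var N.*2 a b.
  rewrite /e; case: pselect => [h|h].
    by case: cid2 => x /= x0 xlb; split; [exact: ltW|].
  by split => //; split => // N _; exact: disc_var_ge0.
have [e0 [ep elb]] := eP.
have [|s [/= + cs]] := @segment_compact R (Num.sqrt e) (Num.sqrt M)
  ((fun M => Num.sqrt (disc_var M.+1.*2 a b)) @ \oo) _.
  exists 0%N => // N _; rewrite /= in_itv/= !ler_sqrt ?elb ?ubM//.
  - exact: le_trans (disc_var_ge0 _ _ _) (ubM 1%N isT).
  - exact: disc_var_ge0.
rewrite in_itv/= => /andP[es _]; exists s; split => //.
- exact: le_trans (sqrtr_ge0 _) es.
- by move=> /ep eg0; apply: lt_le_trans es; rewrite sqrtr_gt0.
Qed.

End discretization.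

(** * Exponential integrals of the noises and their laws *)

(** A modification on a null set is the almost sure limit of a constant sequence. *)
Lemma normal_law_ae d (T : measurableType d) (R : realType)
    (P : probability T R) (X Y : T -> R) (m s : R) :
  has_normal_law P X m s -> measurable_fun setT Y ->
  {ae P, forall w, Y w = X w} -> has_normal_law P Y m s.
Proof.
move=> X_law mY XY.
apply: (normal_law_limit (X_ := fun=> X) (s := fun=> s)) => //.
- by apply: filterS XY => w ->; exact: cvg_cst.
- move=> A B [N _ NA] /nbhs_singleton Bs; exists s; split => //.
  by have := NA N; apply => /=.
Qed.

(** The integral is the pointwise limit of Riemann sums, which involve finitely many measurable
    variables; this bypasses joint measurability in time and outcome. *)
Lemma measurable_exp_int d (T : measurableType d) (R : realType) (k t : R)
    (X : R -> T -> R) : 0 < t ->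
  (forall u, 0 <= u -> measurable_fun setT (X u)) -> continuous_paths X ->
  measurable_fun setT (fun w =>
    \int[lebesgue_measure]_(u in `[0, t]) (expR (k * u) * X u w)).
Proof.
move=> t0 mX cX.
apply: (measurable_fun_cvg (h := fun N w =>
  riemann_sum (fun u => expR (k * u) * X (Num.max 0 u) w) t N)).
  move=> N; apply: measurable_sum => l.
  apply: measurable_funM => //; apply: measurable_funM => //.
  by apply: mX; rewrite le_max lexx.
move=> w _.
have -> : \int[lebesgue_measure]_(u in `[0, t]) (expR (k * u) * X u w) =
    \int[lebesgue_measure]_(u in `[0, t]) (expR (k * u) * X (Num.max 0 u) w).
  apply: eq_Rintegral => u; rewrite inE/= in_itv/= => /andP[u0 _].
  by rewrite max_r.
apply: cvg_riemann_sum => // u; apply: cvgM; last first.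
  exact: (continuous_paths_extend (cX w)).
apply: (cvg_comp _ expR); last exact: continuous_expR.
by apply: cvgM; [exact: cvg_cst|exact: cvg_id].
Qed.

Lemma measurable_time_int d (T : measurableType d) (R : realType) (t : R)
    (X : R -> T -> R) : 0 < t ->
  (forall u, 0 <= u -> measurable_fun setT (X u)) -> continuous_paths X ->
  measurable_fun setT (time_int X t).
Proof.
move=> t0 mX cX; have := measurable_exp_int 0 t0 mX cX.
rewrite [X in measurable_fun _ X -> _](_ : _ = time_int X t)//.
apply/funext => w; apply: eq_Rintegral => u _.
by rewrite mul0r expR0 mul1r.
Qed.

Section brownian_functional.
Context dd (T : measurableType dd) (R : realType) (P : probability T R) (n : nat).
Variables (rho : 'M[R]_n) (W : R -> T -> 'cV[R]_n) (kk : 'I_n -> R) (d : R).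
Hypothesis BM : vector_brownian P rho W.
Hypothesis d0 : 0 < d.

Definition exp_int (i : 'I_n) (w : T) : R :=
  \int[lebesgue_measure]_(u in `[0, d]) (expR (kk i * u) * W u w i 0).

Definition brownian_functional (a b : 'cV[R]_n) (w : T) : R :=
  \sum_i (a i 0 * W d w i 0 + b i 0 * exp_int i w).

Let mW i u : 0 <= u -> measurable_fun setT (fun w => W u w i 0).
Proof. by move=> u0; exact: (vbm_measurable BM). Qed.

Let cW (i : 'I_n) (w : T) : continuous (fun u : R => W (Num.max 0 u) w i 0).
Proof.
have h : {within `[0, +oo[, continuous (fun u : R => W u w i 0)} :=
  @vbm_continuous _ _ _ _ _ _ _ BM i w.
exact: continuous_paths_extend h.
Qed.

Lemma measurable_brownian_functional a b :
  measurable_fun setT (brownian_functional a b).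
Proof.
apply: measurable_sum => i; apply: measurable_funD; apply: measurable_funM => //.
- by apply: mW; exact: ltW.
- apply: (@measurable_exp_int _ T R (kk i) d (fun u w => W u w i 0) d0).
    by move=> u u0; exact: mW.
  exact: (vbm_continuous BM).
Qed.

Let exp_intE i w : exp_int i w = \int[lebesgue_measure]_(u in `[0, d])
  (expR (kk i * u) * W (Num.max 0 u) w i 0).
Proof.
apply: eq_Rintegral => u; rewrite inE/= in_itv/= => /andP[u0 _].
by rewrite max_r.
Qed.

(** In each coordinate the constant part of the weights telescopes to the value at [d], and
    summation by parts turns the rest into the Riemann sum that replaces the exponential integral.
    The start at 0 removes the boundary terms. *)
Let disc_sumE (N : nat) a b w : (0 < N)%N -> W 0 w = 0 ->
  \sum_(k < N) ((disc_coef kk d N a b k)^T *m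
     (W (d / N%:R * k.+1%:R) w - W (d / N%:R * k%:R) w)) 0 0 =
  \sum_i (a i 0 * W d w i 0 + b i 0 *
    riemann_sum (fun u => expR (kk i * u) * W (Num.max 0 u) w i 0) d N).
Proof.
move=> N0 W0; have N0' : (0 : R) < N%:R by rewrite ltr0n.
under eq_bigr do rewrite lincombE.
rewrite exchange_big/=; apply: eq_bigr => i _.
pose w_ (k : nat) := W (d / N%:R * k%:R) w i 0.
have w_0 : w_ 0%N = 0 by rewrite /w_ mulr0 W0 mxE.
transitivity (\sum_(k < N) (a i 0 * (w_ k.+1 - w_ k) +
    b i 0 * (disc_weight kk d N i k * (w_ k.+1 - w_ k)))).
  by apply: eq_bigr => k _; rewrite !mxE /w_; ring.
rewrite big_split/= -!big_distrr/=; congr (_ * _ + _ * _).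
  rewrite -(big_mkord xpredT (fun k => w_ k.+1 - w_ k)) telescope_sumr//.
  by rewrite w_0 subr0 /w_ divfK ?gt_eqF.
rewrite (abel_sum N (fun l => d / N%:R * expR (kk i * (d / N%:R * l%:R))) w_).
apply: eq_bigr => l _; rewrite w_0 subr0 -mulrA /w_ max_r//.
by rewrite mulr_ge0// divr_ge0// ltW.
Qed.

Lemma brownian_functional_law a b s :
  cluster ((fun M => Num.sqrt (disc_var rho kk d M.+1.*2 a b)) @ \oo) s ->
  has_normal_law P (brownian_functional a b) 0 s.
Proof.
apply: (normal_law_limit (X_ := fun M w =>
  \sum_(k < M.+1.*2) ((disc_coef kk d M.+1.*2 a b k)^T *m
     (W (d / M.+1.*2%:R * k.+1%:R) w - W (d / M.+1.*2%:R * k%:R) w)) 0 0)).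
- move=> M; set N := M.+1.*2; pose t (k : nat) : R := d / N%:R * k%:R.
  have t0 k : 0 <= t k by rewrite mulr_ge0// divr_ge0// ltW.
  have tS k : t k <= t k.+1 by rewrite ler_wpM2l ?ler_nat// divr_ge0// ltW.
  have tB k : t k.+1 - t k = d / N%:R.
    by rewrite -mulrBr -natrB// subSnn mulr1.
  have := independent_sum_law (fun k => vbm_increment BM (t0 k) (tS k))
    (@vbm_independent _ _ _ _ _ _ _ BM N t (t0 0%N) tS) (disc_coef kk d N a b).
  have -> : \sum_(k < N) qform ((t k.+1 - t k) *: rho) (disc_coef kk d N a b k) =
      disc_var rho kk d N a b.
    apply: eq_bigr => k _; rewrite tB /qform -scalemxAr -scalemxAl.
    by rewrite [LHS]mxE.
  exact.
- exact: measurable_brownian_functional.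
- apply: filterS (vbm_start BM) => w W0.
  rewrite (_ : (fun M => _) = (fun M => \sum_i (a i 0 * W d w i 0 + b i 0 *
    riemann_sum (fun u => expR (kk i * u) * W (Num.max 0 u) w i 0)
      d M.+1.*2))); last first.
    by apply/funext => M; rewrite disc_sumE.
  apply: cvg_big => [|i _]; first exact: add_continuous.
  apply: cvgD; first exact: cvg_cst.
  apply: cvgM; first exact: cvg_cst.
  rewrite exp_intE.
  (* Even numbers of steps form a subsequence, along which the Riemann sums still converge. *)
  apply: (cvg_comp (fun M => M.+1.*2) (riemann_sum _ d) (G := \oo)).
    by move=> A [N _ NA]; exists N => // M /= NM; apply: NA => /=; lia.
  apply: cvg_riemann_sum => // u; apply: cvgM; last exact: cW.
  apply: (cvg_comp _ expR); last exact: continuous_expR.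
  by apply: cvgM; [exact: cvg_cst|exact: cvg_id].
Qed.

End brownian_functional.

Lemma OU_solution d (T : measurableType d) (R : realType) (P : probability T R)
    (k m s y t : R) (B X : R -> T -> R) :
  OU_process P k m s y B X -> continuous_paths B -> 0 < t ->
  exists c1 c2 : R, {ae P, forall w,
    let K := \int[lebesgue_measure]_(u in `[0, t]) (expR (k * u) * B u w) in
    time_int X t w = c1 + s * expR (- k * t) * K /\
    X t w = c2 - k * (s * expR (- k * t) * K) + s * B t w}.
Proof.
move=> [_ cX XE] cB t0.
pose c := expR (- k * t) *
  \int[lebesgue_measure]_(u in `[0, t]) (expR (k * u) * (y + k * m * u)).
exists c, (y + k * m * t - k * c); apply: filterS XE => w Xw /=.
have maxE (f : R -> R) (a : R) :
    \int[lebesgue_measure]_(u in `[0, a]) f (Num.max 0 u) =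
    \int[lebesgue_measure]_(u in `[0, a]) f u.
  apply: eq_Rintegral => u; rewrite inE/= in_itv/= => /andP[u0 _].
  by rewrite max_r.
have [|IE XtE] := @OU_path_formula R k m y s (fun u => X (Num.max 0 u) w)
  (fun u => B (Num.max 0 u) w) t (continuous_paths_extend (cX w))
  (continuous_paths_extend (cB w)) t0.
  move=> u u0; rewrite (max_r u0) Xw//; congr (_ + _ + _).
  exact/esym/(maxE (fun u => k * (m - X u w))).
rewrite (maxE (fun u => X u w)) in IE.
have EB : \int[lebesgue_measure]_(u in `[0, t]) (expR (k * u) * B (Num.max 0 u) w) =
    \int[lebesgue_measure]_(u in `[0, t]) (expR (k * u) * B u w).
  apply: eq_Rintegral => u; rewrite inE/= in_itv/= => /andP[u0 _].
  by rewrite max_r.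
rewrite EB in IE; rewrite (maxE (fun u => X u w)) (max_r (ltW t0)) in XtE.
have -> : time_int X t w = \int[lebesgue_measure]_(u in `[0, t]) X u w by [].
rewrite XtE IE /c; split; ring.
Qed.

(** * Multivariate normal laws and the Cholesky decomposition *)

(** Polarization: the form at e_i + e_j, minus its values at e_i and e_j, is the sum of two entries
    that are equal by symmetry. *)
Lemma sym_qform_inj (R : realType) n (A B : 'M[R]_n) : A^T = A -> B^T = B ->
  (forall v, qform A v = qform B v) -> A = B.
Proof.
move=> AT BT AB.
have ent (M : 'M[R]_n) i j :
    ((delta_mx i 0 : 'cV[R]_n)^T *m M *m (delta_mx j 0 : 'cV[R]_n)) 0 0 = M i j.
  by rewrite -colE mxE trmx_delta -rowE mxE.
have AC (M : 'M[R]_n) i j : M^T = M -> M j i = M i j.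
  by move=> MT; rewrite -[in LHS]MT mxE.
apply/matrixP => i j.
have := AB (1 *: delta_mx i 0 + 1 *: delta_mx j 0); rewrite !qformD !ent !AB.
by rewrite (AC A i j)// (AC B i j)//; lra.
Qed.

Lemma cov_mx_sym d (T : measurableType d) (R : realType) (P : probability T R)
    n (X : T -> 'cV[R]_n) : (cov_mx P X)^T = cov_mx P X.
Proof. by apply/matrixP => i j; rewrite !mxE covarianceC. Qed.

(** The covariance matrix is identified through the variances of linear combinations alone, which
    determine a symmetric matrix. *)
Lemma multinormal_of_laws d (T : measurableType d) (R : realType)
    (P : probability T R) n (X : T -> 'cV[R]_n) m (S : 'M[R]_n) :
  S^T = S -> (forall a, 0 <= qform S a) ->
  (forall a : 'cV[R]_n, has_normal_law P (fun w => (a^T *m X w) 0 0)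
     ((a^T *m m) 0 0) (Num.sqrt (qform S a))) ->
  multinormal P X m S.
Proof.
move=> ST S0 X_law.
have nX (a : 'cV[R]_n) : normal_rv P (fun w => (a^T *m X w) 0 0).
  exact: normal_law_rv (sqrtr_ge0 _) (X_law a).
split => //.
  apply/colP => i; rewrite mxE.
  have := normal_law_expectation (X_law (delta_mx i 0)).
  rewrite lincomb_delta => -> /=.
  exact: (congr1 (fun f => f tt) (lincomb_delta (fun _ : unit => m) i)).
apply: sym_qform_inj => // [|v]; first exact: cov_mx_sym.
rewrite -variance_lincomb; last exact: normal_lincomb_Lfun2.
by rewrite (normal_law_variance (X_law v)) /= sqr_sqrtr.
Qed.

Lemma multinormal_cov d (T : measurableType d) (R : realType)
    (P : probability T R) n (X : T -> 'cV[R]_n) m (S : 'M[R]_n) :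
  multinormal P X m S -> S^T = S /\ forall a, 0 <= qform S a.
Proof.
move=> [nX _ <-]; split=> [|a]; first exact: cov_mx_sym.
rewrite -variance_lincomb; last exact: normal_lincomb_Lfun2.
by rewrite fine_ge0// variance_ge0.
Qed.

Lemma qform_mul (R : realType) n k (S : 'M[R]_n) (A : 'M[R]_(k, n)) a :
  qform (A *m S *m A^T) a = qform S (A^T *m a).
Proof. by rewrite /qform trmx_mul trmxK !mulmxA. Qed.

Lemma multinormal_affine d (T : measurableType d) (R : realType)
    (P : probability T R) n k (X : T -> 'cV[R]_n) m (S : 'M[R]_n)
    (A : 'M[R]_(k, n)) (c : 'cV[R]_k) :
  multinormal P X m S ->
  multinormal P (fun w => c + A *m X w) (c + A *m m) (A *m S *m A^T).
Proof.
move=> X_mn; have [ST S0] := multinormal_cov X_mn.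
apply: multinormal_of_laws => [|a|a].
- by rewrite !trmx_mul trmxK ST mulmxA.
- by rewrite qform_mul.
rewrite qform_mul.
have := normal_lawD_cst ((a^T *m c) 0 0) (multinormal_lincomb (A^T *m a) X_mn).
have E (v : 'cV[R]_n) : (a^T *m c) 0 0 + ((A^T *m a)^T *m v) 0 0 =
    (a^T *m (c + A *m v)) 0 0.
  by rewrite trmx_mul trmxK mulmxDr mulmxA [RHS]mxE.
by rewrite E; under eq_fun do rewrite E.
Qed.

Definition posdef_mx (R : realType) n (A : 'M[R]_n) : Prop :=
  A^T = A /\ forall v, v != 0 -> 0 < qform A v.

Lemma posdef_rank (R : realType) n (A : 'M[R]_n) : posdef_mx A -> \rank A = n.
Proof.
move=> [AT A0]; apply/eqP; rewrite -/(row_free A) -kermx_eq0.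
apply/rowV0P => u /sub_kermxP uA; apply/eqP.
apply: contraTT isT => u0.
have uT0 : u^T != 0 by rewrite -(inj_eq trmx_inj) trmxK trmx0.
by have := A0 _ uT0; rewrite /qform trmxK uA mul0mx mxE ltxx.
Qed.

(** Induction on the size: the first column of the factor is that of [A] over the square root of its
    corner, and the remaining block factors the Schur complement B - u u^T / a. *)
Lemma cholesky_exists (R : realType) n (A : 'M[R]_n) : posdef_mx A ->
  exists L : 'M[R]_n, is_cholesky A L.
Proof.
elim: n A => [|n IHn] A [AT A0].
  exists 0; split; first by apply/is_trig_mxP => -[].
    by case.
  by apply/matrixP => -[].
pose A1 : 'M[R]_(1 + n) := A.
pose a := A1 0 0; pose u : 'cV[R]_n := dlsubmx A1; pose B := drsubmx A1.
have AE : A1 = block_mx a%:M u^T u B.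
  rewrite -[LHS]submxK; congr block_mx.
    apply/matrixP => i j; rewrite !mxE !ord1 eqxx mulr1n /A1 /a.
    by congr (A1 _ _); apply/val_inj.
  by rewrite /u trmx_dlsub AT.
have BT : B^T = B by rewrite /B trmx_drsub AT.
have a0 : 0 < a.
  have /A0 : (delta_mx 0 0 : 'cV[R]_n.+1) != 0.
    apply/eqP => /matrixP/(_ 0 0); rewrite !mxE !eqxx => /eqP.
    by rewrite oner_eq0.
  by rewrite /qform -colE mxE trmx_delta -rowE mxE.
have [L [Ltrig Lpos LE]] : exists L, is_cholesky (B - a^-1 *: (u *m u^T)) L.
  apply: IHn; split=> [|v v0].
    by rewrite linearB/= linearZ/= trmx_mul trmxK BT.
  (* The first entry minimizes the form of [A] for the given [v]: it kills the first block of A x,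
     and the minimum is the form of the Schur complement at [v]. *)
  pose x : 'cV[R]_(1 + n) := col_mx (- a^-1 *: (u^T *m v)) v.
  have x0 : x != 0.
    apply: contra v0 => /eqP x0; have := congr1 dsubmx x0.
    by rewrite col_mxKd => ->; rewrite linear0.
  have : 0 < (x^T *m A1 *m x) 0 0 := A0 x x0.
  rewrite AE /x -mulmxA mul_block_col tr_col_mx mul_row_col.
  have -> : a%:M *m (- a^-1 *: (u^T *m v)) + u^T *m v = 0.
    rewrite mul_scalar_mx scalerA mulrN divff ?gt_eqF// scaleN1r.
    by rewrite addNr.
  have -> : u *m (- a^-1 *: (u^T *m v)) + B *m v =
      (B - a^-1 *: (u *m u^T)) *m v.
    by rewrite mulmxBl -scalemxAl -scalemxAr scaleNr mulmxA addrC.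
  by rewrite mulmx0 add0r mulmxA.
pose s := Num.sqrt a; have s0 : 0 < s by rewrite sqrtr_gt0.
have sE : s * s = a by rewrite -expr2 sqr_sqrtr// ltW.
pose Lb : 'M[R]_(1 + n) := block_mx s%:M 0 (s^-1 *: u) L.
have LbE : Lb *m Lb^T = A1.
  rewrite AE /Lb tr_block_mx mulmx_block LE.
  rewrite tr_scalar_mx trmx0 linearZ/= !mulmx0 !mul0mx !addr0.
  rewrite -scalar_mxM sE mul_scalar_mx scalerA divff ?gt_eqF// scale1r.
  rewrite mul_mx_scalar scalerA divff ?gt_eqF// scale1r.
  rewrite -scalemxAl -scalemxAr scalerA -invfM sE.
  by rewrite addrC subrK.
exists Lb; split.
- apply/is_trig_mxP => i j.
  case: (@split_ordP 1 n i) => i' ->; case: (@split_ordP 1 n j) => j' ->.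
  + by rewrite !ord1 ltnn.
  + move=> _; transitivity ((0 : 'M[R]_(1, n)) i' j'); last by rewrite mxE.
    exact: block_mxEur.
  + by rewrite /= ord1.
  + rewrite /= ltnS => ij; transitivity (L i' j'); first exact: block_mxEdr.
    by have /is_trig_mxP := Ltrig; apply.
- move=> i; case: (@split_ordP 1 n i) => i' ->.
  + rewrite [X in _ < X](_ : _ = (s%:M : 'M[R]_1) i' i'); last exact: block_mxEul.
    by rewrite mxE eqxx mulr1n.
  + rewrite [X in _ < X](_ : _ = L i' i'); last exact: block_mxEdr.
    exact: Lpos.
- exact: LbE.
Qed.

Lemma sum_ord_inord (R : nmodType) n (F : 'I_n.+1 -> R) :
  \sum_(i < n.+1) F i = \sum_(0 <= k < n.+1) F (inord k).
Proof. by rewrite big_mkord; apply: eq_bigr => i _; rewrite inord_val. Qed.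

Section extend_by_zero.
Context (R : realType) (n : nat).

(** The transpose of [drop_last]: through it the form of the leading block is read as the form of
    the whole matrix. *)
Definition extend_zero (v : 'cV[R]_n) : 'cV[R]_n.+1 :=
  \col_i (if unlift ord_max i is Some j then v j 0 else 0).

Lemma extend_zero_lift v j : extend_zero v (lift ord_max j) 0 = v j 0.
Proof. by rewrite mxE liftK. Qed.

Lemma extend_zero_max v : extend_zero v ord_max 0 = 0.
Proof. by rewrite mxE unlift_none. Qed.

Lemma qform_drop_last (A : 'M[R]_n.+1) v :
  qform (drop_last_mx A) v = qform A (extend_zero v).
Proof.
rewrite !qformE (bigD1_ord ord_max)//= extend_zero_max mul0r add0r.
apply: eq_bigr => i _; rewrite extend_zero_lift; congr (_ * _).
rewrite [RHS](bigD1_ord ord_max)//= extend_zero_max mul0r add0r.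
by apply: eq_bigr => j _; rewrite extend_zero_lift !mxE.
Qed.

Lemma lincomb_drop_last (v : 'cV[R]_n) (z : 'cV[R]_n.+1) :
  (v^T *m drop_last z) 0 0 = ((extend_zero v)^T *m z) 0 0.
Proof.
rewrite !lincombE [RHS](bigD1_ord ord_max)//= extend_zero_max mul0r add0r.
by apply: eq_bigr => i _; rewrite extend_zero_lift mxE.
Qed.

End extend_by_zero.

(** * The model *)

Section loadings.
Context {R : realType}.
Implicit Types (e : 'cV[R]_7).

Definition rates (kappa alpha beta : R) (i : 'I_3) : R :=
  [:: kappa; alpha; beta]`_i.

(* With unit volatilities, [e^T Y] is a constant plus the sum over the three
   noises of [load_W] times the noise at [d] plus [load_K] times the integral of
   [exp (k u)] against the noise. *)
Definition load_W e : 'cV[R]_3 := colv 3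
  [:: e (inord 0) 0; e (inord 6) 0 - e (inord 2) 0; e (inord 4) 0].

Definition load_K (kappa alpha beta d : R) e : 'cV[R]_3 := colv 3
  [:: expR (- kappa * d) * (e (inord 1) 0 - kappa * e (inord 0) 0);
      - (expR (- alpha * d) * (e (inord 3) 0 - alpha * e (inord 2) 0));
      expR (- beta * d) * (e (inord 5) 0 - beta * e (inord 4) 0)].

Lemma colvE n (s : seq R) k : (k < n.+1)%N -> colv n.+1 s (inord k) 0 = s`_k.
Proof. by move=> kn; rewrite mxE inordK. Qed.

Lemma vol_mxE sr sx sp e k : (k < 7)%N ->
  (vol_mx sr sx sp *m e) (inord k) 0 = [:: sr; sr; sx; sx; sp; sp; 1]`_k * e (inord k) 0.
Proof. by move=> k7; rewrite mul_diag_mx mxE [_^T _ _]mxE colvE. Qed.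

(** The common null space of the loadings is the line spanned by (0,0,1,alpha,0,0,1), on which e_6 =
    e_2 and e_3 = alpha e_2; a zero last coordinate leaves only the origin. This is the source of
    the full rank. *)
Lemma load_eq0 kappa alpha beta d e : e (inord 6) 0 = 0 ->
  load_W e = 0 -> load_K kappa alpha beta d e = 0 -> e = 0.
Proof.
move=> e6 /colP W0 /colP K0.
have := W0 (inord 0); rewrite colvE//= mxE => e0.
have := W0 (inord 1); rewrite colvE//= mxE e6 sub0r => /eqP; rewrite oppr_eq0 => /eqP e2.
have := W0 (inord 2); rewrite colvE//= mxE => e4.
have := K0 (inord 0); rewrite colvE//= mxE e0 mulr0 subr0 => /eqP.
rewrite mulf_eq0 gt_eqF ?expR_gt0//= => /eqP e1.
have := K0 (inord 1); rewrite colvE//= mxE e2 mulr0 subr0 => /eqP.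
rewrite oppr_eq0 mulf_eq0 gt_eqF ?expR_gt0//= => /eqP e3.
have := K0 (inord 2); rewrite colvE//= mxE e4 mulr0 subr0 => /eqP.
rewrite mulf_eq0 gt_eqF ?expR_gt0//= => /eqP e5.
apply/colP => i; rewrite mxE -(inord_val i).
by case: i => [[|[|[|[|[|[|[|//]]]]]]]] /= _.
Qed.

(* The coefficients that [a^T Z] puts on the first six components when
   [Z_7 = - Z_3 - alpha Z_4]. *)
Definition fold_seventh (alpha : R) (a : 'cV[R]_7) : 'cV[R]_6 := colv 6
  [:: a (inord 0) 0; a (inord 1) 0; a (inord 2) 0 - a (inord 6) 0;
      a (inord 3) 0 - alpha * a (inord 6) 0; a (inord 4) 0; a (inord 5) 0].

Lemma extend_zero_inord (v : 'cV[R]_6) k : (k < 6)%N ->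
  extend_zero v (inord k) 0 = v (inord k) 0.
Proof.
move=> k6; rewrite -(extend_zero_lift v (inord k)); congr (extend_zero v _ 0).
by apply: val_inj; rewrite /= inordK ?(ltn_trans k6)// inordK// /bump leqNgt k6.
Qed.

Lemma extend_zero_inord6 (v : 'cV[R]_6) : extend_zero v (inord 6) 0 = 0.
Proof.
rewrite -[RHS](extend_zero_max v); congr (extend_zero v _ 0).
by apply: val_inj; rewrite /= inordK.
Qed.

(** Folding subtracts from [a] its last entry times the null vector (0,0,1,alpha,0,0,1), so the
    loadings do not change. *)
Lemma load_W_fold alpha a : load_W (extend_zero (fold_seventh alpha a)) = load_W a.
Proof.
rewrite /load_W extend_zero_inord6 !extend_zero_inord// /fold_seventh !colvE//=.
by rewrite sub0r opprB.
Qed.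

Lemma load_K_fold kappa alpha beta d a :
  load_K kappa alpha beta d (extend_zero (fold_seventh alpha a)) =
  load_K kappa alpha beta d a.
Proof.
rewrite /load_K !extend_zero_inord// /fold_seventh !colvE//=.
by congr (colv 3 [:: _; - (_ * _); _]); ring.
Qed.

Lemma lincomb_fold alpha (a z : 'cV[R]_7) : seventh_rule alpha z ->
  (a^T *m z) 0 0 = ((fold_seventh alpha a)^T *m drop_last z) 0 0.
Proof.
move=> z7; rewrite lincomb_drop_last !lincombE !sum_ord_inord.
do 7 (rewrite big_ltn//); rewrite big_geq//.
do 7 (rewrite [in RHS]big_ltn//); rewrite big_geq//.
rewrite extend_zero_inord6 !extend_zero_inord// /fold_seventh !colvE//= z7.
by ring.
Qed.

End loadings.

(** * Laws of linear combinations of Y *)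

Section model_law.
Context d (T : measurableType d) (R : realType) (P : probability T R).
Variables (rho : 'M[R]_3) (kappa alpha beta sr sx sp : R).
Variables (rbar xbar pbar r0 x0 p0 t : R) (Wr WS Wp r x p : R -> T -> R).
Hypothesis HY : model P rho kappa alpha beta sr sx sp
  rbar xbar pbar r0 x0 p0 Wr WS Wp r x p.
Hypothesis t0 : 0 < t.

Let W (u : R) (w : T) : 'cV[R]_3 := colv 3 [:: Wr u w; WS u w; Wp u w].

Let BM : vector_brownian P rho W := model_BM HY.

Let W0 : (fun u w => W u w (inord 0) 0) = Wr.
Proof. by apply/funext => u; apply/funext => w; rewrite /W colvE. Qed.

Let W1 : (fun u w => W u w (inord 1) 0) = WS.
Proof. by apply/funext => u; apply/funext => w; rewrite /W colvE. Qed.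

Let W2 : (fun u w => W u w (inord 2) 0) = Wp.
Proof. by apply/funext => u; apply/funext => w; rewrite /W colvE. Qed.

Let cW0 : continuous_paths Wr.
Proof. by rewrite -W0; exact: (@vbm_continuous _ _ _ _ _ _ _ BM). Qed.

Let cW1 : continuous_paths WS.
Proof. by rewrite -W1; exact: (@vbm_continuous _ _ _ _ _ _ _ BM). Qed.

Let cW2 : continuous_paths Wp.
Proof. by rewrite -W2; exact: (@vbm_continuous _ _ _ _ _ _ _ BM). Qed.

Let Y := Yvec WS r x p t.

(** Almost sure equality with a measurable functional does not by itself give measurability, so
    [normal_law_ae] takes it separately. *)
Lemma measurable_Y_lincomb (e : 'cV[R]_7) :
  measurable_fun setT (fun w => (e^T *m Y w) 0 0).
Proof.
have mWS : measurable_fun setT (WS t).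
  have := @vbm_measurable _ _ _ _ _ _ _ BM t (inord 1) (ltW t0).
  by rewrite (congr1 (fun f => f t) W1).
have OUr := model_r HY; have OUx := model_x HY; have OUp := model_p HY.
have mt X k m s y B (H : OU_process P k m s y B X) : measurable_fun setT (time_int X t).
  by apply: measurable_time_int => //; [exact: OU_measurable H|exact: OU_continuous H].
have mX X k m s y B (H : OU_process P k m s y B X) : measurable_fun setT (X t).
  by apply: (OU_measurable H); exact: ltW.
rewrite [X in measurable_fun _ X](_ : _ = fun w => e (inord 0) 0 * r t w
  + (e (inord 1) 0 * time_int r t w + (e (inord 2) 0 * x t w
  + (e (inord 3) 0 * time_int x t w + (e (inord 4) 0 * p t w
  + (e (inord 5) 0 * time_int p t w + e (inord 6) 0 * WS t w)))))); last first.
  apply/funext => w; rewrite lincombE sum_ord_inord.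
  by do 7 (rewrite big_ltn//); rewrite big_geq// /Y /Yvec !colvE//= addr0.
have mtr := mt _ _ _ _ _ _ OUr; have mtx := mt _ _ _ _ _ _ OUx.
have mtp := mt _ _ _ _ _ _ OUp; have mr := mX _ _ _ _ _ _ OUr.
have mx := mX _ _ _ _ _ _ OUx; have mp := mX _ _ _ _ _ _ OUp.
by repeat (apply: measurable_funD; first by apply: measurable_funM);
  apply: measurable_funM.
Qed.

(** A component and its integral carry the same volatility, and the last entry of Y is the noise
    itself, so all volatilities, zero included, are absorbed in [vol_mx sr sx sp *m e]. The
    coefficient - sx in the equation of x accounts for the signs in the second entries of the
    loadings. *)
Lemma Y_lincombE (e : 'cV[R]_7) : exists m : R, {ae P, forall w,
  (e^T *m Y w) 0 0 = m + brownian_functional W (rates kappa alpha beta) t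
    (load_W (vol_mx sr sx sp *m e))
    (load_K kappa alpha beta t (vol_mx sr sx sp *m e)) w}.
Proof.
have [cr1 [cr2 Er]] := OU_solution (model_r HY) cW0 t0.
have [cx1 [cx2 Ex]] := OU_solution (model_x HY) cW1 t0.
have [cp1 [cp2 Ep]] := OU_solution (model_p HY) cW2 t0.
exists (e (inord 0) 0 * cr2 + e (inord 1) 0 * cr1 + e (inord 2) 0 * cx2
  + e (inord 3) 0 * cx1 + e (inord 4) 0 * cp2 + e (inord 5) 0 * cp1).
apply: filterS3 Er Ex Ep => w [Er1 Er2] [Ex1 Ex2] [Ep1 Ep2].
rewrite /brownian_functional sum_ord_inord.
do 3 (rewrite big_ltn//); rewrite big_geq//.
have K0 : exp_int W (rates kappa alpha beta) t (inord 0) w =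
    \int[lebesgue_measure]_(u in `[0, t]) (expR (kappa * u) * Wr u w).
  by apply: eq_Rintegral => u _; rewrite /rates inordK//= /W colvE.
have K1 : exp_int W (rates kappa alpha beta) t (inord 1) w =
    \int[lebesgue_measure]_(u in `[0, t]) (expR (alpha * u) * WS u w).
  by apply: eq_Rintegral => u _; rewrite /rates inordK//= /W colvE.
have K2 : exp_int W (rates kappa alpha beta) t (inord 2) w =
    \int[lebesgue_measure]_(u in `[0, t]) (expR (beta * u) * Wp u w).
  by apply: eq_Rintegral => u _; rewrite /rates inordK//= /W colvE.
rewrite K0 K1 K2 /load_W /load_K /W !colvE//= !vol_mxE//=.
rewrite lincombE sum_ord_inord.
do 7 (rewrite big_ltn//); rewrite big_geq// /Y /Yvec !colvE//=.
rewrite Er1 Er2 Ex1 Ex2 Ep1 Ep2.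
ring.
Qed.

(** The mean stays existential because only variances are compared between models. *)
Lemma Y_lincomb_law (e : 'cV[R]_7) (s : R) :
  cluster ((fun M => Num.sqrt (disc_var rho (rates kappa alpha beta) t M.+1.*2
    (load_W (vol_mx sr sx sp *m e))
    (load_K kappa alpha beta t (vol_mx sr sx sp *m e)))) @ \oo) s ->
  exists m, has_normal_law P (fun w => (e^T *m Y w) 0 0) m s.
Proof.
move=> /(brownian_functional_law BM t0) B_law.
have [m Ym] := Y_lincombE e; exists (m + 0).
exact: (normal_law_ae (normal_lawD_cst m B_law) (measurable_Y_lincomb e) Ym).
Qed.

End model_law.

Lemma vol_mx1 (R : realType) (e : 'cV[R]_7) : vol_mx 1 1 1 *m e = e.
Proof.
apply/colP => i; rewrite -(inord_val i) vol_mxE//.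
by case: i => [[|[|[|[|[|[|[|//]]]]]]]] /= _; rewrite mul1r.
Qed.

(** * The simulation procedure *)

Theorem mainTheorem2 (R : realType)
    (delta kappa alpha beta sr sx sp rho_rS rho_rp rho_Sp : R)
    (delta_gt0 : 0 < delta)
    (sr_ge0 : 0 <= sr) (sx_ge0 : 0 <= sx) (sp_ge0 : 0 <= sp)
    (rho_corr : is_correlation_mx (corr_mx rho_rS rho_rp rho_Sp))
    (rho_full : \rank (corr_mx rho_rS rho_rp rho_Sp) = 3%N)
    (* the model with volatilities sr, sx, sp *)
    (d : measure_display) (T : measurableType d) (P : probability T R)
    (rbar xbar pbar r0 x0 p0 : R) (Wr WS Wp r x p : R -> T -> R)
    (HY : model P (corr_mx rho_rS rho_rp rho_Sp) kappa alpha beta sr sx sp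
            rbar xbar pbar r0 x0 p0 Wr WS Wp r x p)
    (* any model with unit volatilities and the same kappa, alpha, beta, rho *)
    (d1 : measure_display) (T1 : measurableType d1) (P1 : probability T1 R)
    (rbar1 xbar1 pbar1 r01 x01 p01 : R)
    (Wr1 WS1 Wp1 r1 x1 p1 : R -> T1 -> R)
    (HY1 : model P1 (corr_mx rho_rS rho_rp rho_Sp) kappa alpha beta 1 1 1
             rbar1 xbar1 pbar1 r01 x01 p01 Wr1 WS1 Wp1 r1 x1 p1) :
  let Y := Yvec WS r x p delta in
  let m := mean_vec P Y in
  let Sigma := cov_mx P Y in
  let C := cov_mx P1 (Yvec WS1 r1 x1 p1 delta) in
  let C6 := drop_last_mx C in
  let D := vol_mx sr sx sp in
  [/\ (* (i) *)
      [/\ Sigma = D *m C *m D,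
          multinormal P Y m Sigma &
          forall (d' : measure_display) (T' : measurableType d')
                 (P' : probability T' R) (Z : T' -> 'cV[R]_7),
            multinormal P' Z 0 C ->
            multinormal P' (fun w => m + D *m Z w) m Sigma],
      (* (ii) *)
      [/\ forall (d' : measure_display) (T' : measurableType d')
                 (P' : probability T' R) (Z : T' -> 'cV[R]_7),
            multinormal P' Z 0 C ->
            cov_mx P' (fun w => drop_last (Z w)) = C6,
          \rank C6 = 6%N,
          exists L : 'M[R]_6, is_cholesky C6 L &
          forall (L : 'M[R]_6) (d' : measure_display)
                 (T' : measurableType d') (P' : probability T' R)
                 (xi : T' -> 'cV[R]_6),
            is_cholesky C6 L -> multinormal P' xi 0 1%:M ->
            multinormal P' (fun w => L *m xi w) 0 C6],
      (* (iii) *)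
      forall (d' : measure_display) (T' : measurableType d')
             (P' : probability T' R) (Z : T' -> 'cV[R]_7),
        multinormal P' (fun w => drop_last (Z w)) 0 C6 ->
        (forall w, seventh_rule alpha (Z w)) ->
        multinormal P' Z 0 C &
      (* the simulation procedure *)
      forall (L : 'M[R]_6) (d' : measure_display) (T' : measurableType d')
             (P' : probability T' R) (xi : T' -> 'cV[R]_6)
             (Z : T' -> 'cV[R]_7),
        is_cholesky C6 L -> multinormal P' xi 0 1%:M ->
        (forall w, drop_last (Z w) = L *m xi w) ->
        (forall w, seventh_rule alpha (Z w)) ->
        multinormal P' (fun w => m + D *m Z w) m Sigma].
Proof.
move=> Y m Sigma C C6 D.
have [rho_sym _ rho_psd] := rho_corr.
set rho := corr_mx rho_rS rho_rp rho_Sp in rho_corr rho_full HY HY1 rho_sym rho_psd *.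
have rho_unit : rho \in unitmx by rewrite -row_free_unit /row_free rho_full.
pose kk := rates kappa alpha beta.
(* One cluster point is fixed for each pair of coefficients, independently of [P] and [P1], so that
   [sd] is shared by both models. *)
have /choice[sd sdP] : forall ab : 'cV[R]_3 * 'cV[R]_3, exists s : R,
    [/\ 0 <= s, ab != (0, 0) -> 0 < s &
     cluster ((fun M => Num.sqrt (disc_var rho kk delta M.+1.*2 ab.1 ab.2)) @ \oo) s].
  by move=> [a b]; exact: disc_sd_cluster.
pose load e := (load_W e, load_K kappa alpha beta delta e).
pose vv e := sd (load e).
have Y_law e : exists m', has_normal_law P (fun w => (e^T *m Y w) 0 0) m' (vv (D *m e)).
  by apply: (Y_lincomb_law HY delta_gt0); have [] := sdP (load (D *m e)).
have Y1_law e : exists m', has_normal_law P1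
    (fun w => (e^T *m Yvec WS1 r1 x1 p1 delta w) 0 0) m' (vv e).
  apply: (Y_lincomb_law HY1 delta_gt0); rewrite vol_mx1.
  by have [] := sdP (load e).
have vv0 e : 0 <= vv e by have [] := sdP (load e).
have nY (a : 'cV[R]_7) : normal_rv P (fun w => (a^T *m Y w) 0 0).
  by have [m' h] := Y_law a; exact: normal_law_rv h.
have nY1 (a : 'cV[R]_7) : normal_rv P1 (fun w => (a^T *m Yvec WS1 r1 x1 p1 delta w) 0 0).
  by have [m' h] := Y1_law a; exact: normal_law_rv h.
have qSigma e : qform Sigma e = vv (D *m e) ^+ 2.
  rewrite -variance_lincomb; last exact: normal_lincomb_Lfun2.
  by have [m' h] := Y_law e; rewrite (normal_law_variance h).
have qC e : qform C e = vv e ^+ 2.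
  rewrite -variance_lincomb; last exact: normal_lincomb_Lfun2.
  by have [m' h] := Y1_law e; rewrite (normal_law_variance h).
have DT : D^T = D by rewrite tr_diag_mx.
have C_sym : C^T = C by exact: cov_mx_sym.
(* Both quadratic forms take the value [vv (D *m e) ^+ 2] at [e]. *)
have SigmaE : Sigma = D *m C *m D.
  apply: sym_qform_inj => [||e]; first exact: cov_mx_sym.
    by rewrite !trmx_mul DT C_sym mulmxA.
  by rewrite -[X in _ *m X]DT qform_mul DT qC qSigma.
have simulate (d' : measure_display) (T' : measurableType d')
    (P' : probability T' R) (Z : T' -> 'cV[R]_7) :
    multinormal P' Z 0 C -> multinormal P' (fun w => m + D *m Z w) m Sigma.
  move=> /(multinormal_affine D m); rewrite mulmx0 addr0 DT.
  by rewrite SigmaE.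
have complete (d' : measure_display) (T' : measurableType d')
    (P' : probability T' R) (Z : T' -> 'cV[R]_7) :
    multinormal P' (fun w => drop_last (Z w)) 0 C6 ->
    (forall w, seventh_rule alpha (Z w)) -> multinormal P' Z 0 C.
  move=> Z6 Z7; apply: multinormal_of_laws => // a.
    by rewrite qC sqr_ge0.
  have := multinormal_lincomb (fold_seventh alpha a) Z6.
  (* The folded coefficients, extended by 0, have the loadings of [a], so the two values of [sd]
     agree and the scale is the one prescribed by [C]. *)
  rewrite qform_drop_last qC /vv /load load_W_fold load_K_fold -/(load a) -/(vv a) -qC.
  rewrite !mulmx0 !mxE (_ : (fun w => _) = (fun w => (a^T *m Z w) 0 0))//.
  by apply/funext => w; rewrite -lincomb_fold.
have C6_pd : posdef_mx C6.
  split; first by apply/matrixP => i j; rewrite !mxE covarianceC.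
  move=> v v0; rewrite qform_drop_last qC exprn_gt0//.
  (* The value of [sd] is positive unless both loadings vanish, and with last coordinate 0 that
     forces [v] to be 0. *)
  have [_ + _] := sdP (load (extend_zero v)); apply.
  apply: contra v0; rewrite xpair_eqE => /andP[/eqP W0 /eqP K0].
  have /colP e0 := load_eq0 (extend_zero_inord6 v) W0 K0.
  apply/eqP/colP => j; have := e0 (lift ord_max j).
  by rewrite extend_zero_lift !mxE.
have chol (L : 'M[R]_6) (d' : measure_display) (T' : measurableType d')
    (P' : probability T' R) (xi : T' -> 'cV[R]_6) :
    is_cholesky C6 L -> multinormal P' xi 0 1%:M ->
    multinormal P' (fun w => L *m xi w) 0 C6.
  move=> [_ _ <-] /(multinormal_affine L 0); rewrite mulmx0 addr0 mulmx1.
  by under eq_fun do rewrite add0r.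
split => //.
- split => //.
  + move=> d' T' P' Z [_ _ ZC]; rewrite /C6 -ZC.
    apply/matrixP => i j; rewrite !mxE.
    by congr (fine (covariance _ _ _)); apply/funext => w; rewrite mxE.
  + exact: posdef_rank.
  + exact: cholesky_exists.
- move=> L d' T' P' xi Z LC xi_law ZL Z7; apply: simulate; apply: complete => //.
  rewrite (_ : (fun w => drop_last (Z w)) = (fun w => L *m xi w)).
    exact: chol.
  exact/funext.
Qed.
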